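(* Let $(S,T)$ be an ideal triangulated compact surface with edge set $E$, and let $\lambda\in\mathbb R$. A hyperbolic metric with totally geodesic boundary on $(S,T)$ is determined up to triangulation fixing isometry by its edge invariant $\psi_\lambda:E\to\mathbb R$ (that is, two such metrics with the same $\psi_\lambda$ have the same edge length function). Furthermore, if $\lambda\ge 0$, then the set $P_\lambda\subset\mathbb R^E$ of all $\psi_\lambda$-edge invariants of hyperbolic metrics with totally geodesic boundary on $(S,T)$ is the open convex polytope $$P_\lambda=\Big\{z\in\mathbb R^E:\ \sum_{s=1}^m z(e_{i_s})>0\ \text{ for each edge cycle } \{e_{i_1},\dots,e_{i_m}\}\Big\};$$ in particular $P_\lambda=P_0$.
   Context: An ideal triangulated compact surface $(S,T)$: take a connected closed surface $X$ with a triangulation $T^*$ (obtained by gluing finitely many triangles along their edges in pairs; cells need not be embedded), and let $S$ be $X$ minus a small open regular neighbourhood of the vertices. The edges (set $E$) and 2-cells (hexagons) of $T$ are the intersections with $S$ of the edges and triangles of $T^*$. Each hexagon has three edges (counted with multiplicity) and three boundary arcs in $\partial S$, called B-arcs, corresponding to the corners of the triangle; a B-arc faces the edge opposite to the corner and is adjacent to the other two edges. A hyperbolic metric with totally geodesic boundary on $(S,T)$ is identified (up to triangulation fixing isometry) with its edge length function $l:E\to\mathbb R_{>0}$: every $l\in\mathbb R_{>0}^E$ occurs, by realizing each 2-cell with edges $e_i,e_j,e_k$ as the unique hyperbolic right-angled hexagon with three pairwise non-adjacent edges of lengths $l_i=l(e_i),l_j=l(e_j),l_k=l(e_k)$ and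 gluing along these edges. The length $\theta_i$ of the B-arc facing $e_i$ is given by $\cosh\theta_i=\dfrac{\cosh l_i+\cosh l_j\cosh l_k}{\sinh l_j\sinh l_k}$. The edge invariant is $\psi_\lambda(e)=\int_0^{(b+c-a)/2}\cosh^\lambda(t)\,dt+\int_0^{(b'+c'-a')/2}\cosh^\lambda(t)\,dt$, where $a,a'$ are the lengths of the two B-arcs facing $e$, and $b,c$ (resp. $b',c'$) are the lengths of the other two B-arcs in the hexagon containing the arc of length $a$ (resp. $a'$). An edge cycle is an edge loop in the 1-skeleton of the dual cell decomposition, without backtracking: edges $e_{i_1},\dots,e_{i_m}\in E$ and 2-cells $H_1,\dots,H_m$ (indices mod $m$) such that for each $s$, $e_{i_s}$ and $e_{i_{s+1}}$ are two different sides of $H_s$, and $H_{s-1},H_s$ lie on the two sides of $e_{i_s}$. Edges may be repeated in a cycle. *)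

(* Defs.v *)
From HB Require Import structures.
From mathcomp Require Import all_boot all_order all_algebra.
From mathcomp Require Import all_classical all_reals all_analysis.

Set Implicit Arguments.
Unset Strict Implicit.
Unset Printing Implicit Defensive.

Import Order.TTheory GRing.Theory Num.Theory.
Import numFieldNormedType.Exports.

Local Open Scope classical_set_scope.
Local Open Scope ring_scope.

(* A closed connected surface obtained by gluing finitely many triangles along
   their edges in pairs, recorded combinatorially.  A cell [H] has the three
   sides [(H, 0)], [(H, 1)], [(H, 2)] in cyclic order; two sides are glued to
   each other when they are the two distinct sides carrying the same edge.  The
   two sides of an edge may belong to the same cell, and two cells may share
   several edges.  After truncation of the vertices, the cell [H] is a hexagon,
   and its corner opposite to the side [(H, i)] is the B-arc facing that side;
   B-arcs are therefore also indexed by [cell * 'I_3].  The truth value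
   [orientation_matching e] tells which of the two identifications of the two
   sides of [e] is used: the one respecting the cyclic boundary orientations of
   the triangles, or the one reversing them.  It influences the topology of the
   surface, but neither lengths nor edge cycles depend on it. *)
Record ideal_triangulation := IdealTriangulation {
  edge : finType;
  cell : finType;
  side_edge : cell * 'I_3 -> edge;
  orientation_matching : edge -> bool;
  card_sides : forall e : edge, #|[set p | side_edge p == e]%SET| = 2%N;
  cell_nonempty : (0 < #|cell|)%N;
  cell_connected : forall H K : cell,
    connect (fun H1 H2 => [exists i, exists j,
               side_edge (H1, i) == side_edge (H2, j)]) H K }.

Section hyperbolic_functions.
Context {R : realType}.
Implicit Types x y : R.

Definition cosh x : R := (expR x + expR (- x)) / 2.
Definition sinh x : R := (expR x - expR (- x)) / 2.

(* meaningful for [1 <= y], see [acosh_ge0] and [acoshK] *)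
Definition acosh y : R := ln (y + Num.sqrt (y ^+ 2 - 1)).

Lemma acosh_ge0 y : 1 <= y -> 0 <= acosh y.
Proof.
by move=> y1; apply: ln_ge0; rewrite (le_trans y1)// lerDl sqrtr_ge0.
Qed.

Lemma acoshK y : 1 <= y -> cosh (acosh y) = y.
Proof.
move=> y1; rewrite /cosh /acosh expRN.
set s := Num.sqrt _.
have s2 : s ^+ 2 = y ^+ 2 - 1 by rewrite sqr_sqrtr// subr_ge0 expr_ge1// (le_trans ler01).
have ys : 0 < y + s by rewrite (lt_le_trans ltr01)// (le_trans y1)// lerDl sqrtr_ge0.
rewrite lnK ?posrE//.
have -> : (y + s)^-1 = y - s.
  apply: (mulfI (lt0r_neq0 ys)); rewrite mulfV ?lt0r_neq0//.
  by rewrite mulrC -subr_sqr s2 opprB addrC subrK.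
by rewrite addrACA subrr addr0 -mulr2n -(mulr_natr y) mulfK// pnatr_eq0.
Qed.

Lemma cosh_gt0 x : 0 < cosh x.
Proof. by rewrite divr_gt0// addr_gt0// expR_gt0. Qed.

Lemma sinh_gt0 x : 0 < x -> 0 < sinh x.
Proof. by move=> x0; rewrite divr_gt0// subr_gt0 ltr_expR gtrN. Qed.

Lemma sinh_lt_cosh x : sinh x < cosh x.
Proof. by rewrite ltr_pM2r ?invr_gt0// ltrD2l gtrN ?expR_gt0. Qed.

Definition oriented_integral (f : R -> R) (a b : R) : R :=
  if a <= b then (\int[lebesgue_measure]_(t in `[a, b]) f t)%R
  else - (\int[lebesgue_measure]_(t in `[b, a]) f t)%R.

End hyperbolic_functions.

Section edge_invariant.
Context {R : realType} (T : ideal_triangulation).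
Implicit Types (l z : edge T -> R) (p : cell T * 'I_3).

(* Up to triangulation fixing isometry, a hyperbolic metric with totally
   geodesic boundary is its edge length function. *)
Definition hyperbolic_metric l : Prop := forall e, 0 < l e.

(* Indices in ['I_3] are added modulo 3, so the sides (resp. B-arcs) of [p.1]
   other than [p] are [rot_side p 1] and [rot_side p 2]. *)
Definition rot_side p (k : 'I_3) : cell T * 'I_3 := (p.1, p.2 + k).

Definition side_length l p : R := l (side_edge p).

Definition B_arc_length l p : R :=
  let li := side_length l p in
  let lj := side_length l (rot_side p 1) in
  let lk := side_length l (rot_side p 2) in
  acosh ((cosh li + cosh lj * cosh lk) / (sinh lj * sinh lk)).

Lemma cosh_B_arc_length l p : hyperbolic_metric l ->
  cosh (B_arc_length l p) =
  (cosh (side_length l p)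
     + cosh (side_length l (rot_side p 1)) * cosh (side_length l (rot_side p 2)))
  / (sinh (side_length l (rot_side p 1)) * sinh (side_length l (rot_side p 2))).
Proof.
move=> l0; apply: acoshK; set x := side_length l (rot_side p 1).
set y := side_length l (rot_side p 2).
have [x0 y0] : 0 < sinh x /\ 0 < sinh y by split; apply: sinh_gt0; apply: l0.
have xy0 : 0 < sinh x * sinh y by exact: mulr_gt0.
rewrite (ler_pdivlMr _ _ xy0) mul1r -[leLHS]add0r.
apply: lerD; first exact/ltW/cosh_gt0.
by apply: ler_pM; rewrite ltW// sinh_lt_cosh.
Qed.

Definition edge_invariant (lambda : R) l (e : edge T) : R :=
  \sum_(p | side_edge p == e)
    oriented_integral (fun t => cosh t `^ lambda) 0
      ((B_arc_length l (rot_side p 1) + B_arc_length l (rot_side p 2)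
        - B_arc_length l p) / 2).

Definition edge_invariants (lambda : R) : set (edge T -> R) :=
  [set edge_invariant lambda l | l in [set l | hyperbolic_metric l]].

(* An edge cycle is recorded by the sides [(H_s, i_s)] through which the cells
   [H_s] are entered; the underlying edge is [side_edge (H_s, i_s)].  The cell
   [p.1] is left through a side [(p.1, j)] different from [p], and the next cell
   is entered through the other side [q] of the same edge. *)
Definition edge_step p q : bool :=
  [exists j : 'I_3, [&& j != p.2, side_edge (p.1, j) == side_edge q
                      & q != (p.1, j)]].

Definition edge_cycle (c : seq (cell T * 'I_3)) : bool :=
  (c != [::]) && cycle edge_step c.

Definition edge_cycle_polytope : set (edge T -> R) :=
  [set z | forall c, edge_cycle c -> 0 < \sum_(p <- c) z (side_edge p)].

End edge_invariant.

Arguments edge_invariants R T lambda : clear implicits.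
Arguments edge_cycle_polytope R T : clear implicits.

(* a finite intersection of open half-spaces of R^I *)
Definition open_convex_polytope (R : realType) (I : finType)
    (P : set (I -> R)) : Prop :=
  exists (n : nat) (a : 'I_n -> I -> R) (b : 'I_n -> R),
    (forall k, exists i, a k i != 0) /\
    P = [set z | forall k, b k < \sum_i a k i * z i].

(* Main.v *)
Require Import Defs.
From HB Require Import structures.
From mathcomp Require Import all_boot all_order all_algebra.
From mathcomp Require Import all_classical all_reals all_analysis.
From mathcomp Require Import ring lra.

(* Let r_i be half the sum of the two B-arcs adjacent to the side i of a hexagon
   minus half the B-arc facing it.  Then tanh (l_i / 2) cosh r_i takes the same
   value rho on the three sides, so with F' = cosh^lambda and
   du_i = tanh (l_i / 2)^(lambda + 1) dl_i one has
   sum_i dF(r_i) du_i = rho^lambda sum_i dr_i tanh (l_i / 2) dl_i,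
   a negative definite quadratic form in dl.  Injectivity follows by integrating
   along a path that is affine in the coordinates u.
   For the image, r_i + r_j > 0 in each hexagon gives the inequalities of the
   polytope.  Conversely, let z satisfy them, and minimise over all metrics a
   function of psi_lambda that blows up at the boundary of the polytope and has
   z as its only critical point.  When psi_lambda stays in a compact subset of
   the polytope, the metrics stay in a compact set: a large r would propagate
   through cells to ever shorter edges, and a long edge would propagate through
   ever thinner B-arcs until an edge cycle with small sum closes up.  At the
   minimum, definiteness forces psi_lambda = z. *)

Set Implicit Arguments.
Unset Strict Implicit.
Unset Printing Implicit Defensive.

Import Order.TTheory GRing.Theory Num.Theory.
Import numFieldNormedType.Exports.

Local Open Scope classical_set_scope.
Local Open Scope ring_scope.

(** * Differentiation, antiderivatives and hyperbolic functions *)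

(** The invariance of [rho] comes from half-side formulas of the hexagon: with defects [x], [y], [z]
    facing the sides [a], [b], [c], [tanh (a / 2) ^+ 2] equals [cosh y * cosh z / (cosh (x + y + z)
    * cosh x)]. Its logarithmic derivative gives the variation of the sides in terms of that of the
    defects, and this direction makes the quadratic form explicit. The coordinates [u] only fill a
    product of intervals, bounded below when [lambda >= 0]. For the image the metrics are therefore
    parametrised by [m = ln l], which ranges over all of R^E, and the function minimised is a
    barrier in the target composed with [psi_lambda]; the definite form is then evaluated once, at
    the minimum, on the vector [w] equal to the gradient of the barrier. The sign of [lambda] enters
    through [F x >= x] for [x >= 0], which converts bounds on [psi_lambda] into bounds on the
    defects (for negative [lambda] the function [F] is bounded), and through a Lipschitz bound for
    [F]. *)

Section calculus.
Context {R : realType}.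
Implicit Types (f g : R -> R) (x y a b : R).

Lemma is_derive_addf f g x a b : is_derive x 1 f a -> is_derive x 1 g b ->
  is_derive x 1 (fun t => f t + g t) (a + b).
Proof. exact: is_deriveD. Qed.

Lemma is_derive_oppf f x a : is_derive x 1 f a ->
  is_derive x 1 (fun t => - f t) (- a).
Proof. exact: is_deriveN. Qed.

Lemma is_derive_mulf f g x a b : is_derive x 1 f a -> is_derive x 1 g b ->
  is_derive x 1 (fun t => f t * g t) (f x * b + g x * a).
Proof. exact: is_deriveM. Qed.

Lemma is_derive_invf f x a : f x != 0 -> is_derive x 1 f a ->
  is_derive x 1 (fun t => (f t)^-1) (- a / f x ^+ 2).
Proof.
by move=> fx fa; apply: is_derive_eq (is_deriveV fx fa) _; rewrite /GRing.scale/=; ring.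
Qed.

Lemma is_derive_sumf (I : Type) (r : seq I) (P : pred I) (h : I -> R -> R)
    (dh : I -> R) x : (forall i, P i -> is_derive x 1 (h i) (dh i)) ->
  is_derive x 1 (fun t => \sum_(i <- r | P i) h i t) (\sum_(i <- r | P i) dh i).
Proof.
move=> hd; elim: r => [|i r IH].
  under eq_fun do rewrite big_nil.
  by rewrite big_nil; exact: is_derive_cst.
under eq_fun do rewrite big_cons.
by rewrite big_cons; case: ifP => // Pi; apply: is_derive_addf => //; exact: hd.
Qed.

Lemma is_derive_compf f g x a b : is_derive (g x) 1 f a -> is_derive x 1 g b ->
  is_derive x 1 (fun t => f (g t)) (a * b).
Proof. exact: is_derive1_comp. Qed.

Lemma is_derive_unique f x a b : is_derive x 1 f a -> is_derive x 1 f b -> a = b.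
Proof. by move=> [_ <-] [_ <-]. Qed.

Lemma is_derive_continuous f x a : is_derive x 1 f a -> {for x, continuous f}.
Proof.
by move=> [/derivable1_diffP fx _]; exact: differentiable_continuous.
Qed.

Lemma is_derive_gt0_lt f (df : R -> R) a b : (forall x, is_derive x 1 f (df x)) ->
  (forall x, 0 < df x) -> a < b -> f a < f b.
Proof.
move=> fd df0 ab.
have cf : {within `[a, b], continuous f}.
  by apply: continuous_subspaceT => x; exact: is_derive_continuous (fd x).
have [c _ fE] := MVT ab (fun x _ => fd x) cf.
by rewrite -subr_gt0 fE mulr_gt0// subr_gt0.
Qed.

Lemma is_derive_oriented_integral f a x : continuous f ->
  is_derive x 1 (oriented_integral f a) (f x).
Proof.
(* The base point [b] lies to the left of [a] and of [x], so for [y] near [x] both branches of the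
   oriented integral equal [G y - G a]. *)
move=> cf; pose b := Num.min a x - 1.
have bax : (b < a) && (b < x) by rewrite /b !ltrBlDr !gt_min !ltrDl ltr01 orbT.
have /andP[ba bx] := bax.
pose G y := (\int[lebesgue_measure]_(t in `[b, y]) f t)%R.
have intf u v : lebesgue_measure.-integrable `[u, v] (EFin \o f).
  apply: continuous_compact_integrable; first exact: segment_compact.
  exact: continuous_subspaceT.
have split_integral u v : b <= u -> u <= v ->
    (\int[lebesgue_measure]_(t in `[u, v]) f t)%R = G v - G u.
  move=> bu uv; rewrite /G Rintegral_itvB ?bnd_simp//.
  rewrite Rintegral_itv_obnd_cbnd//; apply: integrableS (intf u v) => //.
  exact: subset_itv_oc_cc.
have [dG GE] : derivable G x 1 /\ derive1 G x = f x.
  by apply: (@continuous_FTC1_closed _ f b x (x + 1)) => //; rewrite ?ltrDl//; exact: cf.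
apply: (@near_eq_is_derive _ _ _ (fun y => G y - G a)); last first.
  have dGx : is_derive x 1 G (f x).
    by apply: DeriveDef; [exact: dG|rewrite -derive1E; exact: GE].
  by apply: is_derive_eq (is_derive_addf dGx (is_derive_cst (- G a) x 1)) _; rewrite addr0.
near=> y.
have yb : b < y by near: y; apply: lt_nbhsr.
rewrite /oriented_integral; case: ifPn => [ay|].
  by rewrite (split_integral _ _ (ltW ba) ay).
by rewrite -ltNge => ya; rewrite (split_integral _ _ (ltW yb) (ltW ya)) opprB.
Unshelve. all: by end_near. Qed.

Lemma oriented_integral_self f a : oriented_integral f a a = 0.
Proof. by rewrite /oriented_integral lexx set_itv1 Rintegral_set1. Qed.

End calculus.

Section hyperbolic_calculus.
Context {R : realType}.
Implicit Types x y : R.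

Lemma cosh2_sinh2 x : cosh x ^+ 2 - sinh x ^+ 2 = 1.
Proof.
rewrite /cosh /sinh expRN; have := expR_gt0 x; set e := expR x => e0.
by field; rewrite gt_eqF.
Qed.

Lemma coshN x : cosh (- x) = cosh x.
Proof. by rewrite /cosh opprK addrC. Qed.

Lemma sinhN x : sinh (- x) = - sinh x.
Proof. by rewrite /sinh opprK -mulNr opprB. Qed.

Lemma sinh0 : sinh (0 : R) = 0.
Proof. by rewrite /sinh oppr0 subrr mul0r. Qed.

Lemma coshD x y : cosh (x + y) = cosh x * cosh y + sinh x * sinh y.
Proof.
by rewrite /cosh /sinh opprD !expRD; field.
Qed.

Lemma sinhD x y : sinh (x + y) = sinh x * cosh y + cosh x * sinh y.
Proof.
by rewrite /cosh /sinh opprD !expRD; field.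
Qed.

Lemma is_derive_cosh x : is_derive x 1 (@cosh R) (sinh x).
Proof.
apply: is_derive_eq (is_derive_mulf
  (is_derive_addf (is_derive_expR x)
    (is_derive_compf (is_derive_expR (- x)) (is_derive_oppf (is_derive_id x 1))))
  (is_derive_cst (2^-1 : R) x 1)) _.
by rewrite /sinh /=; field.
Qed.

Lemma is_derive_sinh x : is_derive x 1 (@sinh R) (cosh x).
Proof.
apply: is_derive_eq (is_derive_mulf
  (is_derive_addf (is_derive_expR x) (is_derive_oppf
    (is_derive_compf (is_derive_expR (- x)) (is_derive_oppf (is_derive_id x 1)))))
  (is_derive_cst (2^-1 : R) x 1)) _.
by rewrite /cosh /=; field.
Qed.

Lemma cosh_ge1 x : 1 <= cosh x.
Proof.
have := cosh_gt0 x; have := cosh2_sinh2 x; have := sqr_ge0 (sinh x); nra.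
Qed.

Lemma cosh2E x : cosh x ^+ 2 = sinh x ^+ 2 + 1.
Proof. by have /eqP := cosh2_sinh2 x; rewrite subr_eq addrC => /eqP. Qed.

Lemma ltr_sinh x y : x < y -> sinh x < sinh y.
Proof.
exact: is_derive_gt0_lt is_derive_sinh cosh_gt0.
Qed.

Lemma ler_sinh x y : x <= y -> sinh x <= sinh y.
Proof. by rewrite le_eqVlt => /predU1P[->//|/ltr_sinh/ltW]. Qed.

Lemma ler_cosh x y : 0 <= x -> x <= y -> cosh x <= cosh y.
Proof.
move=> x0 xy; have s0 : 0 <= sinh x by rewrite -sinh0 ler_sinh.
have := ler_sinh xy; have := cosh2_sinh2 x; have := cosh2_sinh2 y.
by have := cosh_gt0 x; have := cosh_gt0 y; nra.
Qed.

Lemma ltr_cosh x y : 0 <= x -> x < y -> cosh x < cosh y.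
Proof.
move=> x0 xy; have s0 : 0 <= sinh x by rewrite -sinh0 ler_sinh.
have := ltr_sinh xy; have := cosh2_sinh2 x; have := cosh2_sinh2 y.
by have := cosh_gt0 x; have := cosh_gt0 y; nra.
Qed.

Lemma ler_norm_cosh x y : `|x| <= y -> cosh x <= cosh y.
Proof.
rewrite ler_norml => /andP[yx xy]; have [x0|/ltW x0] := leP 0 x; first exact: ler_cosh.
by rewrite -coshN ler_cosh ?oppr_ge0// lerNl.
Qed.

Lemma sinh_ge_id x : 0 <= x -> x <= sinh x.
Proof.
rewrite le_eqVlt => /predU1P[<-|x0]; first by rewrite sinh0.
have cs : {within `[0, x], continuous sinh}.
  by apply: continuous_subspaceT => t; exact: is_derive_continuous (is_derive_sinh t).
have [c _] := MVT x0 (fun t _ => is_derive_sinh t) cs.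
rewrite sinh0 !subr0 => ->; have := cosh_ge1 c; nra.
Qed.

Lemma acosh_gt0 y : 1 < y -> 0 < acosh y.
Proof.
by move=> y1; apply: ln_gt0; rewrite (lt_le_trans y1)// lerDl sqrtr_ge0.
Qed.

Lemma is_derive_acosh y : 1 < y -> exists d, is_derive y 1 (@acosh R) d.
Proof.
move=> y1; have y2 : 0 < y ^+ 2 - 1 by nra.
have dsqr : is_derive y 1 (fun t => t ^+ 2 - 1) (y * 1 + y * 1 + 0).
  under eq_fun do rewrite expr2.
  exact: is_derive_addf (is_derive_cst (- 1 : R) y 1).
have dsqrt := @is_derive_compf _ _ (fun t => t ^+ 2 - 1) y _ _ (is_derive1_sqrt y2) dsqr.
eexists; apply: (is_derive_compf _ (is_derive_addf (is_derive_id y 1) dsqrt)).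
by apply: is_derive1_ln; rewrite ltr_pwDl ?sqrtr_ge0//; lra.
Qed.

End hyperbolic_calculus.

(** * Right-angled hexagons *)

Section hexagon.
Context {R : realType}.
Implicit Types a b c x y z : R.

Definition B_arc a b c : R :=
  acosh ((cosh a + cosh b * cosh c) / (sinh b * sinh c)).

Definition half_defect a b c : R := (B_arc b c a + B_arc c a b - B_arc a b c) / 2.

Lemma half_defectD a b c : half_defect a b c + half_defect b c a = B_arc c a b.
Proof. by rewrite /half_defect; field. Qed.

Lemma B_arc_arg_gt1 a b c : 0 < b -> 0 < c ->
  1 < (cosh a + cosh b * cosh c) / (sinh b * sinh c).
Proof.
move=> /sinh_gt0 b0 /sinh_gt0 c0.
rewrite ltr_pdivlMr; last exact: mulr_gt0.
have := cosh_gt0 a; have := sinh_lt_cosh b; have := sinh_lt_cosh c; nra.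
Qed.

Lemma B_arc_gt0 a b c : 0 < b -> 0 < c -> 0 < B_arc a b c.
Proof. by move=> b0 c0; apply/acosh_gt0/B_arc_arg_gt1. Qed.

Lemma half_defectD_gt0 a b c : 0 < a -> 0 < b ->
  0 < half_defect a b c + half_defect b c a.
Proof. by rewrite half_defectD; exact: B_arc_gt0. Qed.

Lemma cosh_B_arc a b c : 0 < b -> 0 < c ->
  cosh (B_arc a b c) * (sinh b * sinh c) = cosh a + cosh b * cosh c.
Proof.
move=> b0 c0; rewrite acoshK ?ltW ?B_arc_arg_gt1// divfK// gt_eqF//.
by rewrite mulr_gt0// sinh_gt0.
Qed.

(** The right-hand side is symmetric in the three sides: this is the law of sines of the hexagon,
    with its common value made explicit. *)
Lemma sinh_B_arc a b c : 0 < b -> 0 < c ->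
  sinh (B_arc a b c) * (sinh b * sinh c) =
  Num.sqrt (cosh a ^+ 2 + cosh b ^+ 2 + cosh c ^+ 2
            + 2 * (cosh a * cosh b * cosh c) - 1).
Proof.
move=> b0 c0; have bc0 : 0 < sinh b * sinh c by rewrite mulr_gt0 ?sinh_gt0.
have s0 := sinh_gt0 (B_arc_gt0 a b0 c0).
suff <- : (sinh (B_arc a b c) * (sinh b * sinh c)) ^+ 2 =
    cosh a ^+ 2 + cosh b ^+ 2 + cosh c ^+ 2 + 2 * (cosh a * cosh b * cosh c) - 1.
  by rewrite sqrtr_sqr ger0_norm// ltW// mulr_gt0.
have := cosh_B_arc a b0 c0; have := cosh2_sinh2 (B_arc a b c).
have := cosh2_sinh2 b; have := cosh2_sinh2 c.
set C := cosh (B_arc a b c); set S := sinh (B_arc a b c) => c2 b2 C2 CE.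
rewrite exprMn (_ : S ^+ 2 = C ^+ 2 - 1); last by rewrite -C2; ring.
rewrite mulrBl mul1r -exprMn CE exprMn.
rewrite (_ : sinh b ^+ 2 = cosh b ^+ 2 - 1); last by rewrite -b2; ring.
rewrite (_ : sinh c ^+ 2 = cosh c ^+ 2 - 1); last by rewrite -c2; ring.
by ring.
Qed.

Let disc_ge0 x y z : 1 <= x -> 1 <= y -> 1 <= z ->
  0 <= x ^+ 2 + y ^+ 2 + z ^+ 2 + 2 * (x * y * z) - 1.
Proof.
move=> x1 y1 z1; have xy : 1 <= x * y by nra.
have : 1 <= x * y * z by nra.
have := sqr_ge0 x; have := sqr_ge0 y; have := sqr_ge0 z; lra.
Qed.

Let cosine_law_dual_alg (ca cb cc sa sb sc Ca Cb Cc Sb Sc A : R) :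
  sa != 0 -> sb != 0 -> sc != 0 -> ca ^+ 2 - sa ^+ 2 = 1 ->
  Ca * (sb * sc) = ca + cb * cc -> Cb * (sc * sa) = cb + cc * ca ->
  Cc * (sa * sb) = cc + ca * cb -> Sb * (sc * sa) = A -> Sc * (sa * sb) = A ->
  A ^+ 2 = ca ^+ 2 + cb ^+ 2 + cc ^+ 2 + 2 * (ca * cb * cc) - 1 ->
  ca * (Sb * Sc) = Ca + Cb * Cc.
Proof.
move=> sa0 sb0 sc0 a2 CaE CbE CcE SbE ScE A2.
have K0 : sa ^+ 2 * (sb * sc) != 0 by rewrite !mulf_neq0.
apply: (mulIf K0).
have -> : ca * (Sb * Sc) * (sa ^+ 2 * (sb * sc)) =
  ca * ((Sb * (sc * sa)) * (Sc * (sa * sb))) by ring.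
rewrite SbE ScE -expr2 A2.
have -> : (Ca + Cb * Cc) * (sa ^+ 2 * (sb * sc)) =
  sa ^+ 2 * (Ca * (sb * sc)) + (Cb * (sc * sa)) * (Cc * (sa * sb)) by ring.
rewrite CaE CbE CcE; have -> : sa ^+ 2 = ca ^+ 2 - 1 by rewrite -a2; ring.
by ring.
Qed.

(** Sides and B-arcs play symmetric roles in a right-angled hexagon. Algebraically, the law of sines
    replaces the product of the two hyperbolic sines by a polynomial in the cosines of the sides. *)
Lemma cosine_law_dual a b c : 0 < a -> 0 < b -> 0 < c ->
  cosh a * (sinh (B_arc b c a) * sinh (B_arc c a b)) =
  cosh (B_arc a b c) + cosh (B_arc b c a) * cosh (B_arc c a b).
Proof.
move=> a0 b0 c0.
apply: (cosine_law_dual_alg _ _ _ (cosh2_sinh2 a) (cosh_B_arc a b0 c0)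
  (cosh_B_arc b c0 a0) (cosh_B_arc c a0 b0) (sinh_B_arc b c0 a0)).
- exact: lt0r_neq0 (sinh_gt0 a0).
- exact: lt0r_neq0 (sinh_gt0 b0).
- exact: lt0r_neq0 (sinh_gt0 c0).
- by rewrite sinh_B_arc//; congr Num.sqrt; move: (cosh a) (cosh b) (cosh c) => x y z; ring.
- rewrite sqr_sqrtr; last by apply: disc_ge0; exact: cosh_ge1.
  by move: (cosh a) (cosh b) (cosh c) => x y z; ring.
Qed.

Lemma cosh_half x : cosh x = 2 * sinh (x / 2) ^+ 2 + 1.
Proof.
rewrite {1}[x](_ : _ = x / 2 + x / 2) ?coshD; last by field.
by move: (cosh2_sinh2 (x / 2)); move: (cosh _) (sinh _) => u v; lra.
Qed.

(** Here [h] stands for [sinh (a / 2) ^+ 2], so [cosh a = 2 * h + 1], and the dual law reads [2 h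
    sinh (x + y) sinh (x + z) = cosh (y + z) + cosh (y - z) = 2 cosh y cosh z]. *)
Let sinh_half_side_alg (h Cx Sx Cy Sy Cz Sz : R) : Cx ^+ 2 - Sx ^+ 2 = 1 ->
  (2 * h + 1) * ((Sx * Cz + Cx * Sz) * (Sx * Cy + Cx * Sy)) =
  (Cy * Cz + Sy * Sz) + (Cx * Cz + Sx * Sz) * (Cx * Cy + Sx * Sy) ->
  h * ((Sx * Cy + Cx * Sy) * (Sx * Cz + Cx * Sz)) = Cy * Cz.
Proof.
move=> x2 law; apply/eqP; rewrite -subr_eq0 -(mulrI_eq0 _ (@lregP _ 2 _)) ?pnatr_eq0//.
have -> : 2 * (h * ((Sx * Cy + Cx * Sy) * (Sx * Cz + Cx * Sz)) - Cy * Cz) =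
  (2 * h + 1) * ((Sx * Cz + Cx * Sz) * (Sx * Cy + Cx * Sy))
  - ((Cy * Cz + Sy * Sz) + (Cx * Cz + Sx * Sz) * (Cx * Cy + Sx * Sy))
  + (Cx ^+ 2 - Sx ^+ 2 - 1) * (Cy * Cz - Sy * Sz) by ring.
by rewrite law x2 !subrr mul0r addr0.
Qed.

Let cosh_half_side_alg (h Cx Sx Cy Sy Cz Sz : R) : Cx ^+ 2 - Sx ^+ 2 = 1 ->
  h * ((Sx * Cy + Cx * Sy) * (Sx * Cz + Cx * Sz)) = Cy * Cz ->
  (h + 1) * ((Sx * Cy + Cx * Sy) * (Sx * Cz + Cx * Sz)) =
  ((Cx * Cy + Sx * Sy) * Cz + (Sx * Cy + Cx * Sy) * Sz) * Cx.
Proof.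
move=> x2 hE; rewrite mulrDl mul1r hE -[Cy * Cz]mul1r -x2; ring.
Qed.

(* The hexagon in terms of [x = half_defect a b c] and its two rotations: the
   B-arcs adjacent to the side [a] have lengths [x + y] and [x + z]. *)
Lemma sinh_half_side a b c : 0 < a -> 0 < b -> 0 < c ->
  let x := half_defect a b c in let y := half_defect b c a in
  let z := half_defect c a b in
  sinh (a / 2) ^+ 2 * (sinh (x + y) * sinh (x + z)) = cosh y * cosh z.
Proof.
move=> a0 b0 c0 x y z.
have := cosine_law_dual a0 b0 c0.
have <- : x + y = B_arc c a b := half_defectD a b c.
have <- : x + z = B_arc b c a by rewrite addrC; exact: half_defectD.
have <- : y + z = B_arc a b c := half_defectD b c a.
move: x y z => x y z.
rewrite (cosh_half a) (coshD y) (coshD x z) (coshD x y) (sinhD x z) (sinhD x y).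
exact: sinh_half_side_alg (cosh2_sinh2 x).
Qed.

Lemma cosh_half_side a b c : 0 < a -> 0 < b -> 0 < c ->
  let x := half_defect a b c in let y := half_defect b c a in
  let z := half_defect c a b in
  cosh (a / 2) ^+ 2 * (sinh (x + y) * sinh (x + z)) = cosh (x + y + z) * cosh x.
Proof.
move=> a0 b0 c0 /=; have /= := sinh_half_side a0 b0 c0.
move: (half_defect a b c) (half_defect b c a) (half_defect c a b) => x y z sE.
rewrite (sinhD x z) (sinhD x y) in sE.
rewrite cosh2E (coshD (x + y)) (coshD x y) (sinhD x z) (sinhD x y).
exact: cosh_half_side_alg (cosh2_sinh2 x) sE.
Qed.

(** The B-arcs have dropped out: this polynomial identity is what gets differentiated along a
    deformation. *)
Lemma half_side_ratio a b c : 0 < a -> 0 < b -> 0 < c ->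
  let x := half_defect a b c in let y := half_defect b c a in
  let z := half_defect c a b in
  sinh (a / 2) ^+ 2 * (cosh (x + y + z) * cosh x) =
  cosh (a / 2) ^+ 2 * (cosh y * cosh z).
Proof.
move=> a0 b0 c0 x y z.
by rewrite -(cosh_half_side a0 b0 c0) -(sinh_half_side a0 b0 c0) mulrCA.
Qed.

Definition tanh x : R := sinh x / cosh x.

Lemma tanh_gt0 x : 0 < x -> 0 < tanh x.
Proof. by move=> x0; rewrite divr_gt0 ?cosh_gt0 ?sinh_gt0. Qed.

Let tanh_half_side_alg (Sa Ca Cx Cy Cz Cs : R) : 0 < Ca -> 0 < Cs ->
  Sa ^+ 2 * (Cs * Cx) = Ca ^+ 2 * (Cy * Cz) ->
  (Sa / Ca * Cx) ^+ 2 = Cx * Cy * Cz / Cs.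
Proof.
move=> Ca0 Cs0 rE.
have -> : (Sa / Ca * Cx) ^+ 2 = Sa ^+ 2 * (Cs * Cx) * (Cx / (Cs * Ca ^+ 2)).
  by field; rewrite !gt_eqF.
by rewrite rE; field; rewrite !gt_eqF.
Qed.

(** The right-hand side is invariant under rotation of the hexagon; it is the common value [rho]. *)
Lemma tanh_half_side a b c : 0 < a -> 0 < b -> 0 < c ->
  let x := half_defect a b c in let y := half_defect b c a in
  let z := half_defect c a b in
  tanh (a / 2) * cosh x =
  Num.sqrt (cosh x * cosh y * cosh z / cosh (x + y + z)).
Proof.
move=> a0 b0 c0 x y z.
have t0 : 0 < tanh (a / 2) by rewrite tanh_gt0 ?divr_gt0.
suff <- : (tanh (a / 2) * cosh x) ^+ 2 = cosh x * cosh y * cosh z / cosh (x + y + z).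
  by rewrite sqrtr_sqr ger0_norm// ltW// (mulr_gt0 t0 (cosh_gt0 x)).
exact: tanh_half_side_alg (cosh_gt0 _) (cosh_gt0 _) (half_side_ratio a0 b0 c0).
Qed.

Lemma tanh_half_side_eq a b c : 0 < a -> 0 < b -> 0 < c ->
  tanh (a / 2) * cosh (half_defect a b c) = tanh (b / 2) * cosh (half_defect b c a).
Proof.
move=> a0 b0 c0; have := tanh_half_side a0 b0 c0; have := tanh_half_side b0 c0 a0.
move=> /= -> ->; move: (half_defect a b c) (half_defect b c a) (half_defect c a b).
move=> x y z; rewrite -(mulrA (cosh x) (cosh y)) (mulrC (cosh x)).
by rewrite -(addrA x y) (addrC x).
Qed.

End hexagon.

(** * First-order variation of a hexagon *)

Section variation.
Context {R : realType}.
Implicit Types (a b c x y z : R).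

(** Sylvester's criterion with the variables in the order [y], [z], [x]: [al] and [be] are the first
    two leading minors and [4 * D] is the determinant. The coefficient [a1] may be negative, as one
    defect of a hexagon may be. *)
Lemma quadratic_form_gt0 a1 a2 a3 x y z : 0 < a2 -> 0 < a3 ->
  0 < 2 * (a1 * a2 * a3) + a1 * a2 + a1 * a3 + a2 * a3 ->
  [|| x != 0, y != 0 | z != 0] ->
  0 < (x + y + z) ^+ 2 + 2 * (a1 * x ^+ 2 + a2 * y ^+ 2 + a3 * z ^+ 2).
Proof.
move=> a20 a30 D0 xyz0.
set Q := _ + _.
pose al := 1 + 2 * a2; pose be := al * (1 + 2 * a3) - 1.
pose D := 2 * (a1 * a2 * a3) + a1 * a2 + a1 * a3 + a2 * a3.
have al0 : 0 < al by rewrite /al; lra.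
have be0 : 0 < be by rewrite /be /al; nra.
have alQ : al * Q = (al * y + x + z) ^+ 2 + ((al * (1 + 2 * a1) - 1) * x ^+ 2
    + be * z ^+ 2 + 2 * (al - 1) * (x * z)).
  by rewrite /Q /be /al; ring.
have beQ : be * (al * Q) = be * (al * y + x + z) ^+ 2
    + (be * z + (al - 1) * x) ^+ 2 + 4 * al * D * x ^+ 2.
  by rewrite alQ /D /be /al; ring.
suff : 0 < be * (al * Q) by rewrite !pmulr_rgt0.
rewrite beQ; have sq_gt0 (u : R) : u != 0 -> 0 < u ^+ 2 by move=> u0; rewrite exprn_even_gt0.
have [x0|x0] := eqVneq x 0; last first.
  apply: ltr_wpDl; first by apply: addr_ge0 (sqr_ge0 _); rewrite mulr_ge0 ?sqr_ge0 ?ltW.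
  by rewrite mulr_gt0 ?sq_gt0// mulr_gt0// mulr_gt0.
rewrite x0 expr0n /= !mulr0 !addr0; have [z0|z0] := eqVneq z 0; last first.
  apply: ltr_wpDl; first by rewrite mulr_ge0 ?sqr_ge0 ?ltW.
  by rewrite sq_gt0// mulf_neq0// gt_eqF.
have y0 : y != 0 by move: xyz0; rewrite x0 z0 eqxx /= orbF.
rewrite z0 !mulr0 !addr0 expr0n addr0; apply: mulr_gt0 => //; apply: sq_gt0.
by rewrite mulf_neq0// gt_eqF.
Qed.

Lemma tanhD_mul x y z : tanh (x + y + z) *
  (1 + (tanh x * tanh y + tanh y * tanh z + tanh z * tanh x)) =
  tanh x + tanh y + tanh z + tanh x * tanh y * tanh z.
Proof.
have := cosh_gt0 (x + y + z); rewrite /tanh !(sinhD (x + y)) !(coshD (x + y)).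
rewrite !sinhD !coshD => s0; field.
by rewrite !gt_eqF ?cosh_gt0.
Qed.

Lemma tanhD_denom_gt0 x y z :
  0 < 1 + (tanh x * tanh y + tanh y * tanh z + tanh z * tanh x).
Proof.
suff -> : 1 + (tanh x * tanh y + tanh y * tanh z + tanh z * tanh x) =
    cosh (x + y + z) / (cosh x * cosh y * cosh z).
  exact: divr_gt0 (cosh_gt0 _) (mulr_gt0 (mulr_gt0 (cosh_gt0 x) (cosh_gt0 y)) (cosh_gt0 z)).
rewrite (coshD (x + y)) sinhD coshD /tanh; field.
by rewrite !gt_eqF ?cosh_gt0.
Qed.

Lemma tanhD_sum_gt0 x y : 0 < x + y -> 0 < tanh x + tanh y.
Proof.
move=> /sinh_gt0 xy0.
suff -> : tanh x + tanh y = sinh (x + y) / (cosh x * cosh y).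
  exact: divr_gt0 xy0 (mulr_gt0 (cosh_gt0 x) (cosh_gt0 y)).
by rewrite sinhD /tanh; field; rewrite !gt_eqF ?cosh_gt0.
Qed.

Lemma tanhB_sum x y z : tanh (x + y + z) - tanh x =
  sinh (y + z) / (cosh (x + y + z) * cosh x).
Proof.
rewrite (_ : y + z = (x + y + z) + (- x)); last by ring.
rewrite (sinhD (x + y + z)) coshN sinhN /tanh.
by field; rewrite !gt_eqF ?cosh_gt0.
Qed.

(** For the variations [p], [q], [r] of the three defects, this is, up to a negative factor, the
    form [sum_i dr_i tanh (l_i / 2) dl_i]. *)
Let half_defect_form x y z p q r :=
  let T := tanh (x + y + z) in
  ((T - tanh x) * p + (T - tanh y) * q + (T - tanh z) * r) ^+ 2
  + 2 * (tanh x * (T - tanh x) * p ^+ 2 + tanh y * (T - tanh y) * q ^+ 2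
         + tanh z * (T - tanh z) * r ^+ 2).

(** In the variables [(T - t_i) p_i] the coefficients are [t_i / (T - t_i)]. By the addition formula
    for [tanh], the determinant condition becomes, up to positive factors,
    [(tx + ty) * (ty + tz) * (tz + tx) > 0], and these sums are positive because the B-arcs are. *)
Let half_defect_form_gt0_aux x y z p q r :
  0 < x + y -> 0 < y + z -> 0 < z + x -> 0 < y -> 0 < z ->
  [|| p != 0, q != 0 | r != 0] -> 0 < half_defect_form x y z p q r.
Proof.
move=> xy yz zx y0 z0 pqr.
have Tx0 : 0 < tanh (x + y + z) - tanh x.
  rewrite tanhB_sum; exact: divr_gt0 (sinh_gt0 yz) (mulr_gt0 (cosh_gt0 _) (cosh_gt0 _)).
have Ty0 : 0 < tanh (x + y + z) - tanh y.
  rewrite (_ : x + y + z = y + z + x); last by ring.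
  rewrite tanhB_sum; exact: divr_gt0 (sinh_gt0 zx) (mulr_gt0 (cosh_gt0 _) (cosh_gt0 _)).
have Tz0 : 0 < tanh (x + y + z) - tanh z.
  rewrite (_ : x + y + z = z + x + y); last by ring.
  rewrite tanhB_sum; exact: divr_gt0 (sinh_gt0 xy) (mulr_gt0 (cosh_gt0 _) (cosh_gt0 _)).
have E := tanhD_mul x y z; have P := tanhD_denom_gt0 x y z.
have s1 := tanhD_sum_gt0 xy; have s2 := tanhD_sum_gt0 yz; have s3 := tanhD_sum_gt0 zx.
have := tanh_gt0 y0; have := tanh_gt0 z0.
rewrite /half_defect_form; move: E P s1 s2 s3 Tx0 Ty0 Tz0.
set T := tanh (x + y + z); set tx := tanh x; set ty := tanh y; set tz := tanh z.
move=> E P s1 s2 s3 Tx0 Ty0 Tz0 tz0 ty0.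
have := @quadratic_form_gt0 (tx / (T - tx)) (ty / (T - ty)) (tz / (T - tz))
  ((T - tx) * p) ((T - ty) * q) ((T - tz) * r) _ _ _ _.
rewrite (_ : tx / (T - tx) * ((T - tx) * p) ^+ 2 + ty / (T - ty) * ((T - ty) * q) ^+ 2
  + tz / (T - tz) * ((T - tz) * r) ^+ 2 =
  tx * (T - tx) * p ^+ 2 + ty * (T - ty) * q ^+ 2 + tz * (T - tz) * r ^+ 2); last first.
  by field; rewrite !gt_eqF.
apply.
- exact: divr_gt0.
- exact: divr_gt0.
- rewrite [ltRHS](_ : _ = (T * (tx * ty + ty * tz + tz * tx) - tx * ty * tz) /
    ((T - tx) * (T - ty) * (T - tz))); last by field; rewrite !gt_eqF.
  apply: divr_gt0; last by apply: mulr_gt0 => //; exact: mulr_gt0.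
  rewrite -(pmulr_rgt0 _ P).
  rewrite [ltRHS](_ : _ = (tx * ty + ty * tz + tz * tx) * (T * (1 + (tx * ty + ty * tz + tz * tx)))
    - (1 + (tx * ty + ty * tz + tz * tx)) * (tx * ty * tz)); last by ring.
  rewrite E [ltRHS](_ : _ = (tx + ty) * (ty + tz) * (tz + tx)); last by ring.
  by apply: mulr_gt0 => //; exact: mulr_gt0.
- by rewrite !mulf_eq0 (gt_eqF Tx0) (gt_eqF Ty0) (gt_eqF Tz0).
Qed.

Lemma half_defect_form_gt0 x y z p q r :
  0 < x + y -> 0 < y + z -> 0 < z + x ->
  [|| p != 0, q != 0 | r != 0] ->
  let T := tanh (x + y + z) in
  0 < ((T - tanh x) * p + (T - tanh y) * q + (T - tanh z) * r) ^+ 2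
  + 2 * (tanh x * (T - tanh x) * p ^+ 2 + tanh y * (T - tanh y) * q ^+ 2
         + tanh z * (T - tanh z) * r ^+ 2).
Proof.
move=> xy yz zx pqr; suff : 0 < half_defect_form x y z p q r by [].
have rot u v w k l m : half_defect_form u v w k l m = half_defect_form v w u l m k.
  rewrite /half_defect_form (_ : u + v + w = v + w + u); last by ring.
  by ring.
(* Pairwise sums are positive, so at most one of the three defects is nonpositive; rotation puts it
   in first place. *)
have [y0|y0] := ltrP 0 y; have [z0|z0] := ltrP 0 z.
- exact: half_defect_form_gt0_aux.
- rewrite -rot; apply: half_defect_form_gt0_aux => //; first by lra.
  by move: pqr; case: (p != 0); case: (q != 0); case: (r != 0).
- rewrite rot; apply: half_defect_form_gt0_aux => //; first by lra.
  by move: pqr; case: (p != 0); case: (q != 0); case: (r != 0).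
- by exfalso; lra.
Qed.

Let variation_alg (Cs Cx Cy Cz Sxy Syz Szx T tx ty tz sa ca sb cb sc cc
    x' y' z' a' b' c' : R) :
  0 < Cs -> 0 < Cx -> 0 < Cy -> 0 < Cz -> 0 < Sxy -> 0 < Syz -> 0 < Szx ->
  0 < ca -> 0 < cb -> 0 < cc ->
  T - tx = Syz / (Cs * Cx) -> T - ty = Szx / (Cs * Cy) -> T - tz = Sxy / (Cs * Cz) ->
  sa ^+ 2 * (Sxy * Szx) = Cy * Cz -> sb ^+ 2 * (Syz * Sxy) = Cz * Cx ->
  sc ^+ 2 * (Szx * Syz) = Cx * Cy ->
  a' = sa * ca * (ty * y' + tz * z' - tx * x' - T * (x' + y' + z')) ->
  b' = sb * cb * (tz * z' + tx * x' - ty * y' - T * (x' + y' + z')) ->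
  c' = sc * cc * (tx * x' + ty * y' - tz * z' - T * (x' + y' + z')) ->
  0 < ((T - tx) * x' + (T - ty) * y' + (T - tz) * z') ^+ 2
    + 2 * (tx * (T - tx) * x' ^+ 2 + ty * (T - ty) * y' ^+ 2
           + tz * (T - tz) * z' ^+ 2) ->
  x' * (sa / ca * a') + y' * (sb / cb * b') + z' * (sc / cc * c') < 0.
Proof.
move=> Cs0 Cx0 Cy0 Cz0 Sxy0 Syz0 Szx0 ca0 cb0 cc0 Tx Ty Tz aS bS cS aE bE cE.
(* [C] is the ratio of [sinh (a / 2) ^+ 2] to [T - tanh x], and it is the same for the three
   sides. *)
pose C := Cs * (Cx * Cy * Cz) / (Sxy * Syz * Szx).
have C0 : 0 < C.
  by rewrite divr_gt0// mulr_gt0// mulr_gt0// mulr_gt0.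
have aSE : sa ^+ 2 = C * (T - tx).
  apply: (mulIf (lt0r_neq0 (mulr_gt0 Sxy0 Szx0))).
  by rewrite aS Tx /C; field; rewrite !gt_eqF.
have bSE : sb ^+ 2 = C * (T - ty).
  apply: (mulIf (lt0r_neq0 (mulr_gt0 Syz0 Sxy0))).
  by rewrite bS Ty /C; field; rewrite !gt_eqF.
have cSE : sc ^+ 2 = C * (T - tz).
  apply: (mulIf (lt0r_neq0 (mulr_gt0 Szx0 Syz0))).
  by rewrite cS Tz /C; field; rewrite !gt_eqF.
set F := _ ^+ 2 + _ => F0.
rewrite -oppr_gt0 [ltRHS](_ : _ = C * F); first exact: mulr_gt0.
rewrite aE bE cE.
have tE (s k u : R) : 0 < k -> s / k * (s * k * u) = s ^+ 2 * u.
  by move=> k0; field; rewrite gt_eqF.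
by rewrite !tE// aSE bSE cSE /F; ring.
Qed.

Lemma half_defect_variation_lt0 a b c a' b' c' x' y' z' :
  0 < a -> 0 < b -> 0 < c ->
  let x := half_defect a b c in let y := half_defect b c a in
  let z := half_defect c a b in
  let T := tanh (x + y + z) in
  a' = sinh (a / 2) * cosh (a / 2)
    * (tanh y * y' + tanh z * z' - tanh x * x' - T * (x' + y' + z')) ->
  b' = sinh (b / 2) * cosh (b / 2)
    * (tanh z * z' + tanh x * x' - tanh y * y' - T * (x' + y' + z')) ->
  c' = sinh (c / 2) * cosh (c / 2)
    * (tanh x * x' + tanh y * y' - tanh z * z' - T * (x' + y' + z')) ->
  [|| a' != 0, b' != 0 | c' != 0] ->
  x' * (tanh (a / 2) * a') + y' * (tanh (b / 2) * b') + z' * (tanh (c / 2) * c') < 0.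
Proof.
move=> a0 b0 c0 x y z T aE bE cE abc0.
have xy : 0 < x + y := half_defectD_gt0 c a0 b0.
have yz : 0 < y + z := half_defectD_gt0 a b0 c0.
have zx : 0 < z + x := half_defectD_gt0 b c0 a0.
have pqr : [|| x' != 0, y' != 0 | z' != 0].
  apply: contraLR abc0; rewrite !negb_or !negbK => /and3P[/eqP x0 /eqP y0 /eqP z0].
  have E (k u v w t : R) : k * (u * 0 + v * 0 - w * 0 - t * (0 + 0 + 0)) = 0 by ring.
  by rewrite aE bE cE x0 y0 z0 !E eqxx.
have form0 := half_defect_form_gt0 xy yz zx pqr.
have aS : sinh (a / 2) ^+ 2 * (sinh (x + y) * sinh (x + z)) = cosh y * cosh z.
  exact: sinh_half_side.
have bS : sinh (b / 2) ^+ 2 * (sinh (y + z) * sinh (y + x)) = cosh z * cosh x.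
  exact: sinh_half_side.
have cS : sinh (c / 2) ^+ 2 * (sinh (z + x) * sinh (z + y)) = cosh x * cosh y.
  exact: sinh_half_side.
subst T; clearbody x y z.
apply: (variation_alg (cosh_gt0 (x + y + z)) (cosh_gt0 x) (cosh_gt0 y) (cosh_gt0 z)
  (sinh_gt0 xy) (sinh_gt0 yz) (sinh_gt0 zx) (cosh_gt0 (a / 2)) (cosh_gt0 (b / 2))
  (cosh_gt0 (c / 2)) (tanhB_sum x y z) _ _ _ _ _ aE bE cE form0).
- by have := tanhB_sum y z x; rewrite (addrC (y + z)) (addrA x).
- by have := tanhB_sum z x y; rewrite -(addrA z) (addrC z (x + y)).
- by rewrite (addrC z).
- by rewrite (addrC x).
- by rewrite (addrC y).
Qed.

Lemma derivable_B_arc (a b c : R -> R) (t a' b' c' : R) :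
  (forall s, 0 < a s) -> (forall s, 0 < b s) -> (forall s, 0 < c s) ->
  is_derive t 1 a a' -> is_derive t 1 b b' -> is_derive t 1 c c' ->
  exists d, is_derive t 1 (fun s => B_arc (a s) (b s) (c s)) d.
Proof.
move=> a0 b0 c0 da db dc.
have [d dd] := is_derive_acosh (B_arc_arg_gt1 (a t) (b0 t) (c0 t)).
have bc0 : sinh (b t) * sinh (c t) != 0.
  exact: lt0r_neq0 (mulr_gt0 (sinh_gt0 (b0 t)) (sinh_gt0 (c0 t))).
have dch f f' : is_derive t 1 f f' -> is_derive t 1 (fun s => cosh (f s)) (sinh (f t) * f').
  exact: is_derive_compf (is_derive_cosh _).
have dsh f f' : is_derive t 1 f f' -> is_derive t 1 (fun s => sinh (f s)) (cosh (f t) * f').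
  exact: is_derive_compf (is_derive_sinh _).
have dnum := is_derive_addf (dch _ _ da) (is_derive_mulf (dch _ _ db) (dch _ _ dc)).
have dden := is_derive_mulf (dsh _ _ db) (dsh _ _ dc).
have := is_derive_mulf dnum (@is_derive_invf _ (fun s => sinh (b s) * sinh (c s)) _ _ bc0 dden).
set e := _ + _ => de.
exists (d * e).
exact: (@is_derive_compf _ acosh (fun s => (cosh (a s) + cosh (b s) * cosh (c s))
  / (sinh (b s) * sinh (c s)))).
Qed.

(** The derivative stays unnamed: [half_defect_linearization] expresses the variation of the sides
    through it. *)
Lemma derivable_half_defect (a b c : R -> R) (t a' b' c' : R) :
  (forall s, 0 < a s) -> (forall s, 0 < b s) -> (forall s, 0 < c s) ->
  is_derive t 1 a a' -> is_derive t 1 b b' -> is_derive t 1 c c' ->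
  exists d, is_derive t 1 (fun s => half_defect (a s) (b s) (c s)) d.
Proof.
move=> a0 b0 c0 da db dc.
have [al dal] := derivable_B_arc a0 b0 c0 da db dc.
have [be dbe] := derivable_B_arc b0 c0 a0 db dc da.
have [ga dga] := derivable_B_arc c0 a0 b0 dc da db.
eexists; exact: is_derive_mulf (is_derive_addf (is_derive_addf dbe dga)
  (is_derive_oppf dal)) (is_derive_cst (2^-1 : R) t 1).
Qed.

Let linearization_alg (Ss Cs Sx Cx Sy Cy Sz Cz sh ch a' x' y' z' : R) :
  0 < Cs -> 0 < Cx -> 0 < Cy -> 0 < Cz -> 0 < sh -> 0 < ch ->
  ch ^+ 2 - sh ^+ 2 = 1 -> sh * sh * (Cs * Cx) = ch * ch * (Cy * Cz) ->
  (sh * sh) * (Cs * (Sx * x') + Cx * (Ss * (x' + y' + z')))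
    + (Cs * Cx) * (sh * (ch * (a' / 2)) + sh * (ch * (a' / 2))) =
  (ch * ch) * (Cy * (Sz * z') + Cz * (Sy * y'))
    + (Cy * Cz) * (ch * (sh * (a' / 2)) + ch * (sh * (a' / 2))) ->
  a' = sh * ch * (Sy / Cy * y' + Sz / Cz * z' - Sx / Cx * x'
                  - Ss / Cs * (x' + y' + z')).
Proof.
move=> Cs0 Cx0 Cy0 Cz0 sh0 ch0 h2 I D.
set B := _ - _ * (x' + y' + z').
have key : a' * sh * ch * (Cs * Cx - Cy * Cz) = sh * sh * (Cs * Cx) * B.
  rewrite {1}/B !mulrBr mulrDr {1 2}I.
  have -> : ch * ch * (Cy * Cz) * (Sy / Cy * y') + ch * ch * (Cy * Cz) * (Sz / Cz * z')
      = (ch * ch) * (Cy * (Sz * z') + Cz * (Sy * y')).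
    by field; rewrite !gt_eqF.
  have -> : ch * ch * (Cy * (Sz * z') + Cz * (Sy * y')) =
      (sh * sh) * (Cs * (Sx * x') + Cx * (Ss * (x' + y' + z')))
      + (Cs * Cx) * (sh * (ch * (a' / 2)) + sh * (ch * (a' / 2)))
      - (Cy * Cz) * (ch * (sh * (a' / 2)) + ch * (sh * (a' / 2))).
    by rewrite D addrK.
  by field; rewrite !gt_eqF.
have chE : ch * ch * (Cs * Cx - Cy * Cz) = Cs * Cx.
  rewrite mulrBr -I -mulrBl -[RHS]mul1r; congr (_ * _).
  by rewrite -h2 !expr2.
have sC : sh * ch * (Cs * Cx) != 0 by rewrite !mulf_neq0// gt_eqF.
apply: (mulIf sC).
have -> : sh * ch * B * (sh * ch * (Cs * Cx)) = (ch * ch) * (sh * sh * (Cs * Cx) * B).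
  by ring.
by rewrite -key -{1}chE; ring.
Qed.

(** This is the logarithmic derivative of [half_side_ratio]: that of [tanh (a / 2) ^+ 2] is
    [a' / (sinh (a / 2) * cosh (a / 2))]. *)
Lemma half_defect_linearization (a b c : R -> R) (t a' x' y' z' : R) :
  (forall s, 0 < a s) -> (forall s, 0 < b s) -> (forall s, 0 < c s) ->
  let x s := half_defect (a s) (b s) (c s) in
  let y s := half_defect (b s) (c s) (a s) in
  let z s := half_defect (c s) (a s) (b s) in
  is_derive t 1 a a' -> is_derive t 1 x x' -> is_derive t 1 y y' ->
  is_derive t 1 z z' ->
  a' = sinh (a t / 2) * cosh (a t / 2)
    * (tanh (y t) * y' + tanh (z t) * z' - tanh (x t) * x'
       - tanh (x t + y t + z t) * (x' + y' + z')).
Proof.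
move=> a0 b0 c0 x y z da dx dy dz.
have dch f f' : is_derive t 1 f f' -> is_derive t 1 (fun s => cosh (f s)) (sinh (f t) * f').
  exact: is_derive_compf (is_derive_cosh _).
have dsh f f' : is_derive t 1 f f' -> is_derive t 1 (fun s => sinh (f s)) (cosh (f t) * f').
  exact: is_derive_compf (is_derive_sinh _).
have da2 : is_derive t 1 (fun s => a s / 2) (a' / 2).
  apply: is_derive_eq (is_derive_mulf da (is_derive_cst (2^-1 : R) t 1)) _.
  by rewrite mulr0 add0r mulrC.
have dL := is_derive_mulf (is_derive_mulf (dsh _ _ da2) (dsh _ _ da2))
  (is_derive_mulf (dch _ _ (is_derive_addf (is_derive_addf dx dy) dz)) (dch _ _ dx)).
have dR := is_derive_mulf (is_derive_mulf (dch _ _ da2) (dch _ _ da2))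
  (is_derive_mulf (dch _ _ dy) (dch _ _ dz)).
have LR s : sinh (a s / 2) * sinh (a s / 2) * (cosh (x s + y s + z s) * cosh (x s)) =
    cosh (a s / 2) * cosh (a s / 2) * (cosh (y s) * cosh (z s)).
  exact: half_side_ratio.
have a20 : 0 < a t / 2 by rewrite divr_gt0.
apply: (linearization_alg (cosh_gt0 _) (cosh_gt0 _) (cosh_gt0 _) (cosh_gt0 _)
  (sinh_gt0 a20) (cosh_gt0 _) (cosh2_sinh2 _) (LR t)).
exact: is_derive_unique (eq_ind _ (fun f => is_derive t 1 f _) dL _ (funext LR)) dR.
Qed.

End variation.

(** * The primitive [F] of [cosh^lambda] *)

Section cosh_power_integral.
Context {R : realType} (lambda : R).
Implicit Types x y : R.

Definition cosh_power_integral x : R :=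
  oriented_integral (fun t => cosh t `^ lambda) 0 x.

Local Notation F := cosh_power_integral.

Lemma cosh_power_gt0 x : 0 < cosh x `^ lambda.
Proof. exact: powR_gt0 (cosh_gt0 x). Qed.

Lemma is_derive_cosh_power_integral x : is_derive x 1 F (cosh x `^ lambda).
Proof.
apply: is_derive_oriented_integral => t.
exact: is_derive_continuous
  (is_derive_compf (is_derive1_powR lambda (cosh_gt0 t)) (is_derive_cosh t)).
Qed.

Lemma cosh_power_integral_mono x y : x < y -> F x < F y.
Proof. exact: is_derive_gt0_lt is_derive_cosh_power_integral cosh_power_gt0. Qed.

Lemma cosh_power_integral_homo x y : x <= y -> F x <= F y.
Proof. by rewrite le_eqVlt => /predU1P[->//|/cosh_power_integral_mono/ltW]. Qed.

Lemma cosh_power_integral0 : F 0 = 0.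
Proof. exact: oriented_integral_self. Qed.

Lemma cosh_power_integralN x : F (- x) = - F x.
Proof.
pose G t := F t + F (- t).
have dG (t : R) : is_derive t 1 G 0.
  apply: is_derive_eq (is_derive_addf (is_derive_cosh_power_integral t)
    (is_derive_compf (is_derive_cosh_power_integral (- t)) (is_derive_oppf (is_derive_id t 1)))) _.
  by rewrite coshN mulrN1 subrr.
have := is_derive_0_is_cst x 0 dG; rewrite /G oppr0 cosh_power_integral0 addr0.
by move=> /addr0_eq <-.
Qed.

(** [F] is odd and increasing. Positivity of a B-arc thus passes to [F] whatever [lambda] is, which
    is why the inequalities of the polytope do not involve [lambda]. *)
Lemma cosh_power_integral_gt0 x y : 0 < x + y -> 0 < F x + F y.
Proof.
move=> xy; rewrite -[F y]opprK -cosh_power_integralN subr_gt0.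
by apply: cosh_power_integral_mono; lra.
Qed.

Let cosh_power_integral_MVT x y : x < y ->
  exists2 c, x < c < y & F y - F x = cosh c `^ lambda * (y - x).
Proof.
move=> xy; have cF : {within `[x, y], continuous F}.
  apply: continuous_subspaceT => t.
  exact: is_derive_continuous (is_derive_cosh_power_integral t).
have [c] := MVT xy (fun t _ => is_derive_cosh_power_integral t) cF.
by rewrite in_itv /= => cxy FE; exists c.
Qed.

Lemma cosh_power_integral_ge_id x : 0 <= lambda -> 0 <= x -> x <= F x.
Proof.
move=> lambda0; rewrite le_eqVlt => /predU1P[<-|x0].
  by rewrite cosh_power_integral0.
have [c _] := cosh_power_integral_MVT x0.
rewrite cosh_power_integral0 !subr0 => ->; rewrite -[leLHS]mul1r ler_pM2r//.
by rewrite -[leLHS](powRr0 (cosh c)); apply: ler_powR lambda0; exact: cosh_ge1.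
Qed.

Lemma cosh_power_integral_lipschitz B x y : 0 <= lambda ->
  - B <= x -> x <= y -> y <= B -> F y - F x <= cosh B `^ lambda * (y - x).
Proof.
move=> lambda0 Bx; rewrite le_eqVlt => /predU1P[->|xy] yB.
  by rewrite !subrr mulr0.
have [c /andP[xc cy] ->] := cosh_power_integral_MVT xy.
rewrite ler_pM2r; last by rewrite subr_gt0.
apply: (ge0_ler_powR lambda0); rewrite ?nnegrE; [exact/ltW/cosh_gt0|exact/ltW/cosh_gt0|].
by apply: ler_norm_cosh; rewrite ler_norml; apply/andP; split; lra.
Qed.

End cosh_power_integral.

Section cell_variation.
Context {R : realType} (lambda : R).
Local Notation F := (cosh_power_integral lambda).

(* The quadratic form of the tangent vector does not depend on [lambda] up to
   the positive factor [rho `^ lambda], where [rho] is the common value of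
   [tanh (l_i / 2) * cosh r_i] over the three sides. *)
Lemma cell_variation (a b c : R -> R) (t a' b' c' u v w : R) :
  (forall s, 0 < a s) -> (forall s, 0 < b s) -> (forall s, 0 < c s) ->
  is_derive t 1 a a' -> is_derive t 1 b b' -> is_derive t 1 c c' ->
  u = tanh (a t / 2) `^ (lambda + 1) * a' ->
  v = tanh (b t / 2) `^ (lambda + 1) * b' ->
  w = tanh (c t / 2) `^ (lambda + 1) * c' ->
  exists F1 F2 F3,
    [/\ is_derive t 1 (fun s => F (half_defect (a s) (b s) (c s))) F1,
        is_derive t 1 (fun s => F (half_defect (b s) (c s) (a s))) F2,
        is_derive t 1 (fun s => F (half_defect (c s) (a s) (b s))) F3,
        F1 * u + F2 * v + F3 * w <= 0 &
        [|| a' != 0, b' != 0 | c' != 0] -> F1 * u + F2 * v + F3 * w < 0].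
Proof.
move=> a0 b0 c0 da db dc uE vE wE.
have [x' dx] := derivable_half_defect a0 b0 c0 da db dc.
have [y' dy] := derivable_half_defect b0 c0 a0 db dc da.
have [z' dz] := derivable_half_defect c0 a0 b0 dc da db.
have aE := half_defect_linearization a0 b0 c0 da dx dy dz.
have bE := half_defect_linearization b0 c0 a0 db dy dz dx.
have cE := half_defect_linearization c0 a0 b0 dc dz dx dy.
have dF f f' : is_derive t 1 f f' ->
    is_derive t 1 (fun s => F (f s)) (cosh (f t) `^ lambda * f').
  exact: is_derive_compf (is_derive_cosh_power_integral _ _).
have dFx := dF _ _ dx; have dFy := dF _ _ dy; have dFz := dF _ _ dz.
have ta0 := tanh_gt0 (divr_gt0 (a0 t) (ltr0n R 2)).
have tb0 := tanh_gt0 (divr_gt0 (b0 t) (ltr0n R 2)).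
have tc0 := tanh_gt0 (divr_gt0 (c0 t) (ltr0n R 2)).
have factor (k r p q : R) : 0 < k -> cosh r `^ lambda * p * (k `^ (lambda + 1) * q)
    = (k * cosh r) `^ lambda * (p * (k * q)).
  move=> k0; rewrite (powRM _ (ltW k0) (ltW (cosh_gt0 r))).
  rewrite powRD ?(powRr1 (ltW k0)); last by rewrite (gt_eqF k0) implybT.
  by move: (cosh r `^ lambda) (k `^ lambda) => m n; ring.
set rho := (tanh (a t / 2) * cosh (half_defect (a t) (b t) (c t))) `^ lambda.
have rho0 : 0 < rho := powR_gt0 _ (mulr_gt0 ta0 (cosh_gt0 _)).
have E : cosh (half_defect (a t) (b t) (c t)) `^ lambda * x' * u
    + cosh (half_defect (b t) (c t) (a t)) `^ lambda * y' * v
    + cosh (half_defect (c t) (a t) (b t)) `^ lambda * z' * w =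
    rho * (x' * (tanh (a t / 2) * a') + y' * (tanh (b t / 2) * b')
           + z' * (tanh (c t / 2) * c')).
  rewrite uE vE wE !factor// -(tanh_half_side_eq (b0 t) (c0 t) (a0 t)).
  by rewrite -(tanh_half_side_eq (a0 t) (b0 t) (c0 t)) -!mulrDr.
have neg : [|| a' != 0, b' != 0 | c' != 0] ->
    x' * (tanh (a t / 2) * a') + y' * (tanh (b t / 2) * b') + z' * (tanh (c t / 2) * c') < 0.
  apply: (half_defect_variation_lt0 (a0 t) (b0 t) (c0 t) aE).
  - rewrite bE /= (_ : y' + z' + x' = x' + y' + z'); last by rewrite addrC addrA.
    by rewrite (addrC (half_defect (b t) (c t) (a t) + _)) addrA.
  - rewrite cE /= (_ : z' + x' + y' = x' + y' + z'); last by rewrite -addrA addrC.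
    by rewrite -(addrA (half_defect (c t) (a t) (b t))) (addrC (half_defect (c t) (a t) (b t))).
do 3 eexists; split; [exact: dFx|exact: dFy|exact: dFz| |].
- rewrite E; have [/neg Q0|] := boolP [|| a' != 0, b' != 0 | c' != 0].
    by rewrite pmulr_rle0// ltW.
  rewrite !negb_or !negbK => /and3P[/eqP-> /eqP-> /eqP->].
  by rewrite !mulr0 !addr0 mulr0.
- by move=> /neg Q0; rewrite E pmulr_rlt0.
Qed.

End cell_variation.

(** * The edge invariant of a triangulated surface *)

Section sides.
Context {R : realType} (T : ideal_triangulation).
Implicit Types (l : edge T -> R) (p q : cell T * 'I_3).

Definition side_defect l p : R :=
  half_defect (side_length l p) (side_length l (rot_side p 1))
    (side_length l (rot_side p 2)).

Lemma rot_sideD p (i j : 'I_3) : rot_side (rot_side p i) j = rot_side p (i + j).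
Proof. by rewrite /rot_side /= addrA. Qed.

Lemma rot_side0 p : rot_side p 0 = p.
Proof. by case: p => H i; rewrite /rot_side /= addr0. Qed.

Lemma ord3D : ((1 + 1 = 2 :> 'I_3)%R * (1 + 2 = 0 :> 'I_3)%R
  * (2 + 1 = 0 :> 'I_3)%R * (2 + 2 = 1 :> 'I_3)%R)%type.
Proof. by do !split; apply: val_inj. Qed.

Lemma ord3P (i : 'I_3) : [\/ i = 0, i = 1 | i = 2].
Proof.
by case: i => -[|[|[|//]]] i3; [constructor 1|constructor 2|constructor 3]; exact: val_inj.
Qed.

Lemma side_defectE l p : side_defect l p =
  (B_arc_length l (rot_side p 1) + B_arc_length l (rot_side p 2) - B_arc_length l p) / 2.
Proof.
by rewrite /side_defect /half_defect /B_arc_length !rot_sideD !ord3D rot_side0.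
Qed.

Lemma edge_invariantE lambda l e : edge_invariant lambda l e =
  \sum_(p | side_edge p == e) cosh_power_integral lambda (side_defect l p).
Proof. by apply: eq_bigr => p _; rewrite side_defectE. Qed.

Lemma side_defect1 l p : side_defect l (rot_side p 1) =
  half_defect (side_length l (rot_side p 1)) (side_length l (rot_side p 2))
    (side_length l p).
Proof. by rewrite /side_defect !rot_sideD !ord3D rot_side0. Qed.

Lemma side_defect2 l p : side_defect l (rot_side p 2) =
  half_defect (side_length l (rot_side p 2)) (side_length l p)
    (side_length l (rot_side p 1)).
Proof. by rewrite /side_defect !rot_sideD !ord3D rot_side0. Qed.

Lemma big_sides (f : cell T * 'I_3 -> R) : \sum_p f p =
  \sum_H (f (H, 0) + f (rot_side (H, 0) 1) + f (rot_side (H, 0) 2)).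
Proof.
rewrite (eq_bigr (fun p => f (p.1, p.2))); last by case.
rewrite -(pair_bigA _ (fun H i => f (H, i)))/=; apply: eq_bigr => H _.
rewrite !big_ord_recl big_ord0 addr0 addrA /rot_side /= !add0r.
by congr (f _ + f _ + f _); congr pair; apply: val_inj.
Qed.

Lemma sum_edge_sides (f : cell T * 'I_3 -> R) (w : edge T -> R) :
  \sum_e (\sum_(p | side_edge p == e) f p) * w e = \sum_p f p * w (side_edge p).
Proof.
rewrite [RHS](partition_big (@side_edge T) xpredT)//=.
apply: eq_bigr => e _; rewrite big_distrl/=.
by apply: eq_bigr => p /eqP ->.
Qed.

Lemma edge_has_side (e : edge T) : exists p, side_edge p = e.
Proof.
have : (0 < #|[set p | side_edge p == e]%SET|)%N by rewrite card_sides.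
by case/card_gt0P => p; rewrite inE => /eqP; exists p.
Qed.

(** Here [w] is the velocity in the coordinates [u]. Regrouped by cells, the sum over edges becomes
    a sum of the nonpositive forms of [cell_variation]; a cell with a side on an edge where [w] is
    nonzero contributes a negative term. *)
Lemma edge_invariant_variation lambda (l : R -> edge T -> R) (t : R)
    (l' w : edge T -> R) :
  (forall s e, 0 < l s e) -> (forall e, is_derive t 1 (fun s => l s e) (l' e)) ->
  (forall e, w e = tanh (l t e / 2) `^ (lambda + 1) * l' e) ->
  exists psi' : edge T -> R,
    (forall e, is_derive t 1 (fun s => edge_invariant lambda (l s) e) (psi' e)) /\
    ((exists e, w e != 0) -> \sum_e psi' e * w e < 0).
Proof.
move=> l0 dl wE.
pose f p s := cosh_power_integral lambda (side_defect (l s) p).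
pose d p : R := 'D_1 (f p) t.
have cellP H : [/\ is_derive t 1 (f (H, 0)) (d (H, 0)),
    is_derive t 1 (f (rot_side (H, 0) 1)) (d (rot_side (H, 0) 1)),
    is_derive t 1 (f (rot_side (H, 0) 2)) (d (rot_side (H, 0) 2)),
    d (H, 0) * w (side_edge (H, 0))
      + d (rot_side (H, 0) 1) * w (side_edge (rot_side (H, 0) 1))
      + d (rot_side (H, 0) 2) * w (side_edge (rot_side (H, 0) 2)) <= 0 &
    [|| w (side_edge (H, 0)) != 0, w (side_edge (rot_side (H, 0) 1)) != 0
      | w (side_edge (rot_side (H, 0) 2)) != 0] ->
    d (H, 0) * w (side_edge (H, 0))
      + d (rot_side (H, 0) 1) * w (side_edge (rot_side (H, 0) 1))
      + d (rot_side (H, 0) 2) * w (side_edge (rot_side (H, 0) 2)) < 0].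
  pose p : cell T * 'I_3 := (H, 0); rewrite -/p.
  have [F1 [F2 [F3 [dF1 dF2 dF3 le0 lt0]]]] := cell_variation
    (fun s => l0 s (side_edge p)) (fun s => l0 s (side_edge (rot_side p 1)))
    (fun s => l0 s (side_edge (rot_side p 2))) (dl (side_edge p))
    (dl (side_edge (rot_side p 1))) (dl (side_edge (rot_side p 2)))
    (wE _) (wE _) (wE _).
  have df1 : is_derive t 1 (f p) F1 by [].
  have E2 : (fun s => cosh_power_integral lambda (half_defect (l s (side_edge (rot_side p 1)))
      (l s (side_edge (rot_side p 2))) (l s (side_edge p)))) = f (rot_side p 1).
    by apply/funext => s; rewrite /f side_defect1.
  have E3 : (fun s => cosh_power_integral lambda (half_defect (l s (side_edge (rot_side p 2)))
      (l s (side_edge p)) (l s (side_edge (rot_side p 1))))) = f (rot_side p 2).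
    by apply/funext => s; rewrite /f side_defect2.
  rewrite E2 in dF2; rewrite E3 in dF3.
  have e1 : d p = F1 by case: df1.
  have e2 : d (rot_side p 1) = F2 by case: dF2.
  have e3 : d (rot_side p 2) = F3 by case: dF3.
  rewrite e1 e2 e3; split; [exact: df1|exact: dF2|exact: dF3|exact: le0|move=> w0; apply: lt0].
  by move: w0; rewrite !wE !mulf_eq0 !negb_or => /or3P[] /andP[_ ->]; rewrite ?orbT.
have df p : is_derive t 1 (f p) (d p).
  case: p => H i; have [d0 d1 d2 _ _] := cellP H.
  have <- : rot_side (H, 0) i = (H, i) by rewrite /rot_side /= add0r.
  have [-> | -> | ->] := ord3P i; [rewrite rot_side0; exact: d0|exact: d1|exact: d2].
exists (fun e => \sum_(p | side_edge p == e) d p); split => [e|[e we0]].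
  rewrite (_ : (fun s => _) = fun s => \sum_(p | side_edge p == e) f p s).
    exact: is_derive_sumf.
  by apply/funext => s; rewrite edge_invariantE.
rewrite sum_edge_sides big_sides; have [[H i] pe] := edge_has_side e.
rewrite (bigD1 H)//= -[ltRHS]addr0 ltr_leD//.
  have [_ _ _ _] := cellP H; apply.
  move: we0; rewrite -pe; have <- : rot_side (H, 0) i = (H, i) by rewrite /rot_side /= add0r.
  have [-> | -> | ->] := ord3P i; rewrite ?rot_side0 => -> //; by rewrite !orbT.
by apply: sumr_le0 => K _; have [] := cellP K.
Qed.

End sides.

(** * Injectivity *)

Section injectivity.
Context {R : realType} (T : ideal_triangulation) (lambda : R).
Implicit Types (l : edge T -> R).

(* In the coordinate [convex_coordinate (ln l)] the edge invariant is the
   gradient of a strictly concave function. *)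
Definition convex_coordinate (m : R) : R :=
  oriented_integral (fun x => tanh (expR x / 2) `^ (lambda + 1) * expR x) 0 m.

Local Notation V := convex_coordinate.

Let dV (m : R) := tanh (expR m / 2) `^ (lambda + 1) * expR m.

Let tanh_expR_gt0 (m : R) : 0 < tanh (expR m / 2).
Proof. by apply: tanh_gt0; rewrite divr_gt0 ?expR_gt0. Qed.

Let dV_gt0 (m : R) : 0 < dV m.
Proof. exact: mulr_gt0 (powR_gt0 _ (tanh_expR_gt0 m)) (expR_gt0 m). Qed.

Lemma is_derive_tanh (x : R) : exists d, is_derive x 1 (@tanh R) d.
Proof.
eexists; exact: is_derive_mulf (is_derive_sinh x)
  (is_derive_invf (lt0r_neq0 (cosh_gt0 x)) (is_derive_cosh x)).
Qed.

Lemma is_derive_convex_coordinate (m : R) : is_derive m 1 V (dV m).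
Proof.
apply: is_derive_oriented_integral => x.
have [d dt] := is_derive_tanh (expR x / 2).
have de : is_derive x 1 (fun y : R => expR y / 2) (expR x * 0 + 2^-1 * expR x).
  exact: is_derive_mulf (is_derive_expR x) (is_derive_cst (2^-1 : R) x 1).
have dth := @is_derive_compf _ tanh (fun y => expR y / 2) x _ _ dt de.
have dpow := @is_derive_compf _ (fun u => u `^ (lambda + 1)) (fun y => tanh (expR y / 2)) x _ _
  (is_derive1_powR (lambda + 1) (tanh_expR_gt0 x)) dth.
exact: is_derive_continuous (is_derive_mulf dpow (is_derive_expR x)).
Qed.

Lemma convex_coordinate_mono (x y : R) : x < y -> V x < V y.
Proof. exact: is_derive_gt0_lt is_derive_convex_coordinate dV_gt0. Qed.

Lemma convex_coordinate_inj : injective V.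
Proof.
by move=> x y Vxy; case: (ltgtP x y) => // /convex_coordinate_mono; rewrite Vxy ltxx.
Qed.

(** [V] need not be onto, so this inverse takes the default value 0 outside its range;
    [convex_coordinate_IVT] keeps the segments of interest inside the range. *)
Let V_inv y := xget 0 [set x | V x = y].

Let V_invK : cancel V V_inv.
Proof.
move=> x; apply: convex_coordinate_inj.
exact: (@xgetPex _ 0 [set z | V z = V x] (ex_intro _ x erefl)).
Qed.

Let is_derive_V_inv x : is_derive (V x) 1 V_inv (dV x)^-1.
Proof.
apply: is_derive_inverse.
- by near=> y; exact: V_invK.
- by near=> y; exact: is_derive_continuous (is_derive_convex_coordinate y).
- exact: is_derive_convex_coordinate.
- exact: lt0r_neq0 (dV_gt0 x).
Unshelve. all: by end_near. Qed.

Let convex_coordinate_IVT x y s : 0 <= s <= 1 ->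
  exists z, V z = V x + s * (V y - V x).
Proof.
move=> /andP[s0 s1].
have cV (a b : R) : {within `[a, b], continuous V}.
  by apply: continuous_subspaceT => t; exact: is_derive_continuous (is_derive_convex_coordinate t).
have [xy|yx] := leP x y.
  have Vxy : V x <= V y.
    by move: xy; rewrite le_eqVlt => /predU1P[->//|/convex_coordinate_mono/ltW].
  have [|z _ Vz] := @IVT _ V x y (V x + s * (V y - V x)) xy (cV _ _); last by exists z.
  rewrite (min_idPl Vxy) (max_idPr Vxy); apply/andP; split; nra.
have Vyx := ltW (convex_coordinate_mono yx).
have [|z _ Vz] := @IVT _ V y x (V x + s * (V y - V x)) (ltW yx) (cV _ _); last by exists z.
rewrite (min_idPl Vyx) (max_idPr Vyx); apply/andP; split; nra.
Qed.

(** Along a segment in the coordinates [u] the velocity [w] is constant, so the pairing of the edge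
    invariant with [w] has as derivative the negative form of [edge_invariant_variation]; it cannot
    agree at the two ends. *)
Lemma edge_invariant_inj l l' : hyperbolic_metric l -> hyperbolic_metric l' ->
  edge_invariant lambda l = edge_invariant lambda l' -> l = l'.
Proof.
move=> l0 l'0 psi_eq; pose w e := V (ln (l e)) - V (ln (l' e)).
have [w0|w0] := pselect (forall e, w e = 0).
  apply/funext => e.
  have Vll' : V (ln (l e)) = V (ln (l' e)) by apply/eqP; rewrite -subr_eq0; apply/eqP; exact: w0.
  by rewrite -(lnK (l0 e)) (convex_coordinate_inj Vll') (lnK (l'0 e)).
have {}w0 : exists e, w e != 0.
  by apply: contra_notP w0 => nw e; apply: contra_notP nw => /eqP we; exists e.
exfalso.
(* The exponential keeps the lengths positive for every real [s], even where [V_inv] returns its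
   default; derivatives are only taken for [s] in [0, 1]. *)
pose L s e := expR (V_inv (V (ln (l' e)) + s * w e)).
have L_gt0 s e : 0 < L s e := expR_gt0 _.
have L0 : L 0 = l'.
  by apply/funext => e; rewrite /L mul0r addr0 V_invK (lnK (l'0 e)).
have L1 : L 1 = l.
  by apply/funext => e; rewrite /L mul1r /w addrC subrK V_invK (lnK (l0 e)).
have dL (s : R) e : 0 <= s <= 1 ->
    is_derive s 1 (fun u => L u e) (w e / tanh (L s e / 2) `^ (lambda + 1)).
  move=> s01; have [z zE] := convex_coordinate_IVT (ln (l' e)) (ln (l e)) s01.
  have dlin : is_derive s 1 (fun u => V (ln (l' e)) + u * w e) (0 + (s * 0 + w e * 1)).
    exact: is_derive_addf (is_derive_cst _ _ _)
      (is_derive_mulf (is_derive_id s 1) (is_derive_cst (w e) s 1)).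
  have dinv : is_derive (V (ln (l' e)) + s * w e) 1 V_inv (dV z)^-1.
    by rewrite -zE; exact: is_derive_V_inv.
  have dU := @is_derive_compf _ V_inv (fun u => V (ln (l' e)) + u * w e) s _ _ dinv dlin.
  have dLs := @is_derive_compf _ expR (fun u => V_inv (V (ln (l' e)) + u * w e)) s _ _
    (is_derive_expR _) dU.
  apply: is_derive_eq dLs _.
  rewrite /L -zE V_invK /dV; have := powR_gt0 (lambda + 1) (tanh_expR_gt0 z).
  move: (tanh (expR z / 2) `^ (lambda + 1)) => p p0; have := expR_gt0 z.
  by move: (expR z) => q q0; field; rewrite !gt_eqF.
have wE (s : R) e : w e = tanh (L s e / 2) `^ (lambda + 1) *
    (w e / tanh (L s e / 2) `^ (lambda + 1)).
  have p0 := powR_gt0 (lambda + 1) (tanh_gt0 (divr_gt0 (L_gt0 s e) (ltr0n R 2))).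
  by rewrite mulrC (divfK (lt0r_neq0 p0)).
pose g (s : R) := \sum_e edge_invariant lambda (L s) e * w e.
have dg (s : R) : 0 <= s <= 1 -> exists2 d, is_derive s 1 g d & d < 0.
  move=> s01.
  have [psi' [dpsi lt0]] := edge_invariant_variation L_gt0 (fun e => dL s e s01) (wE s).
  exists (\sum_e psi' e * w e); last exact: lt0.
  apply: is_derive_eq (is_derive_sumf _ (fun e _ => is_derive_mulf (dpsi e)
    (is_derive_cst (w e) s 1))) _.
  by apply: eq_bigr => e _; rewrite mulr0 add0r mulrC.
have g01 : g 0 = g 1 by rewrite /g L0 L1 psi_eq.
have dg01 (s : R) : s \in `[0, 1]%R -> derivable g s 1.
  by rewrite in_itv /= => /dg[d [? _] _].
have dg01o (s : R) : s \in `]0, 1[%R -> derivable g s 1.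
  by move=> s01; apply: dg01; exact: subset_itv_oo_cc s01.
have [c] := Rolle ltr01 dg01o (derivable_within_continuous dg01) g01.
rewrite in_itv /= => /andP[c0 c1] dg0.
have [|d dgd] := dg c; first by rewrite !ltW.
by rewrite (is_derive_unique dgd dg0) ltxx.
Qed.

End injectivity.

(** * Edge cycles *)

Section cycles.
Implicit Types (S : eqType).

Lemma not_uniq_split S (c : seq S) : ~~ uniq c ->
  exists x c1 c2 c3, c = c1 ++ x :: c2 ++ x :: c3.
Proof.
elim: c => // y c IH /=; rewrite negb_and negbK => /orP[|/IH].
  by case/splitPr => c2 c3; exists y, [::], c2, c3.
by move=> [x [c1 [c2 [c3 ->]]]]; exists x, (y :: c1), c2, c3.
Qed.

(** The subpath between two occurrences closes up. Only one of them is kept, whence the bound by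
    [size c] rather than by the size of [x :: c]. *)
Lemma path_cycle_short S (e : rel S) x c : path e x c -> ~~ uniq (x :: c) ->
  exists2 c', (c' != [::]) && cycle e c' & (size c' <= size c)%N.
Proof.
move=> xc /not_uniq_split[y [[|z c1] [c2 [c3 /= [xE cE]]]]].
  rewrite xE in xc; exists (y :: c2); last by rewrite cE size_cat /= addnS ltnS leq_addr.
  by move: xc; rewrite /= cE cat_path /= rcons_path => /and3P[-> ->].
exists (y :: c2).
  move: xc; rewrite cE cat_path /= cat_path /= rcons_path.
  by move=> /and4P[_ _ -> /andP[-> _]].
by rewrite cE size_cat /= size_cat; apply: leq_trans (leq_addl _ _); rewrite ltnS leq_addr.
Qed.

(** A figure eight is cut at its double point. Equality up to permutation is enough, since only sums
    over cycles matter. *)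
Lemma cycle_split S (e : rel S) c : cycle e c -> ~~ uniq c ->
  exists c1 c2, [/\ (c1 != [::]) && cycle e c1, (c2 != [::]) && cycle e c2
    & perm_eq c (c1 ++ c2)].
Proof.
move=> ec /not_uniq_split[x [c1 [c2 [c3 cE]]]].
exists (x :: c2), (x :: c3 ++ c1).
move: ec; rewrite cE -(rot_cycle (size c1)) rot_size_cat /= -!cats1 -!catA /=.
rewrite !cat_path /= !cat_path /= => /and3P[-> -> ->]; split=> //.
by rewrite perm_catC /= -catA.
Qed.

Lemma path_sum_gt (R : numDomainType) S (e : rel S) (f g : S -> R) x c :
  (forall p q, e p q -> f q - f p < g q) -> path e x c -> c != [::] ->
  f (last x c) - f x < \sum_(y <- c) g y.
Proof.
move=> fg; elim: c x => // y [|z c] IH x /= /andP[xy yc] _.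
  by rewrite big_seq1 fg.
rewrite big_cons -(subrKA (f y)) [X in X < _]addrC.
by rewrite ltrD ?fg//; apply: IH.
Qed.

Lemma path_sum_le (R : numDomainType) S (e : rel S) (f g : S -> R) (d : R) x c :
  (forall p q, e p q -> g q <= f q - f p + d) -> path e x c ->
  \sum_(y <- c) g y <= f (last x c) - f x + d *+ size c.
Proof.
move=> fg; elim: c x => [x _|y c IH x /= /andP[xy yc]].
  by rewrite big_nil subrr addr0.
rewrite big_cons mulrS; apply: le_trans (lerD (fg _ _ xy) (IH _ yc)) _.
by rewrite le_eqVlt; apply/orP; left; apply/eqP; move: (d *+ size c) => k; ring.
Qed.

End cycles.

Section edge_cycles.
Context {R : realType} (T : ideal_triangulation).
Implicit Types (l z : edge T -> R) (p q : cell T * 'I_3).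

Lemma side_defectD_gt0 l p (j : 'I_3) : hyperbolic_metric l -> j != p.2 ->
  0 < side_defect l p + side_defect l (p.1, j).
Proof.
move=> l0 jp; have l0' q : 0 < side_length l q := l0 _.
have -> : (p.1, j) = rot_side p (j - p.2) by rewrite /rot_side addrC subrK.
move: jp; rewrite -subr_eq0; have [-> | -> | ->] := ord3P (j - p.2).
- by rewrite eqxx.
- by rewrite side_defect1 => _; apply: half_defectD_gt0.
- by rewrite side_defect2 addrC => _; apply: half_defectD_gt0.
Qed.

Lemma sum_two_sides (f : cell T * 'I_3 -> R) p q : side_edge p = side_edge q ->
  p != q -> \sum_(x | side_edge x == side_edge q) f x = f p + f q.
Proof.
move=> pq_edge pq.
have -> : \sum_(x | side_edge x == side_edge q) f x =
    \sum_(x in [set p; q]%SET) f x.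
  apply: eq_bigl => x.
  suff -> : [set p; q]%SET = [set x | side_edge x == side_edge q]%SET by rewrite inE.
  apply/eqP; rewrite eqEcard card_sides cards2 pq leqnn andbT.
  by apply/fintype.subsetP => y; rewrite !inE => /orP[] /eqP ->; rewrite ?pq_edge.
by rewrite big_setU1 ?big_set1// inE.
Qed.

Lemma edge_invariant_two_sides lambda l p q : side_edge p = side_edge q -> p != q ->
  edge_invariant lambda l (side_edge q) =
  cosh_power_integral lambda (side_defect l p)
  + cosh_power_integral lambda (side_defect l q).
Proof. by move=> pq_edge pq; rewrite edge_invariantE (sum_two_sides _ pq_edge pq). Qed.

Lemma other_side p : exists2 q, side_edge p = side_edge q & p != q.
Proof.
have : (0 < #|[set q | side_edge q == side_edge p] :\ p|%SET)%N.
  by rewrite -ltnS -[ltnRHS]add1n; have := cardsD1 p [set q | side_edge q == side_edge p]%SET;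
    rewrite card_sides inE eqxx => <-.
case/card_gt0P => q; rewrite !inE => /andP[qp /eqP qe].
by exists q; rewrite // eq_sym.
Qed.

Lemma edge_stepP p q : edge_step p q ->
  exists j, [/\ j != p.2, side_edge (p.1, j) = side_edge q & (p.1, j) != q].
Proof. by move=> /existsP[j /and3P[jp /eqP je jq]]; exists j; split; rewrite // eq_sym. Qed.

(** If the cell is left through [j], then [F] at [j] exceeds minus [F] at [p], their defects adding
    up to a B-arc. Hence [F] of the defect at the entered side is a potential, which telescopes to 0
    around an edge cycle. *)
Lemma edge_step_gt lambda l p q : hyperbolic_metric l -> edge_step p q ->
  cosh_power_integral lambda (side_defect l q)
    - cosh_power_integral lambda (side_defect l p) <
  edge_invariant lambda l (side_edge q).
Proof.
move=> l0 /edge_stepP[j [jp je jq]].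
rewrite (edge_invariant_two_sides lambda l je jq).
have uvw (u v w : R) : 0 < u + w -> v - u < w + v by lra.
exact: uvw (cosh_power_integral_gt0 lambda (side_defectD_gt0 l0 jp)).
Qed.

Lemma cycle_sum_rcons (g : cell T * 'I_3 -> R) p c :
  \sum_(x <- rcons c p) g x = \sum_(x <- p :: c) g x.
Proof. by apply: perm_big; rewrite perm_rcons. Qed.

Lemma edge_invariant_in_polytope lambda l : hyperbolic_metric l ->
  edge_cycle_polytope R T (edge_invariant lambda l).
Proof.
move=> l0 [//|p c] /andP[_ pc].
rewrite -(cycle_sum_rcons (fun x => edge_invariant lambda l (side_edge x))).
have := path_sum_gt (f := fun p => cosh_power_integral lambda (side_defect l p))
  (g := fun p => edge_invariant lambda l (side_edge p))
  (fun p q => @edge_step_gt lambda l p q l0) pc.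
by rewrite last_rcons subrr; apply; case: (c).
Qed.

(** This makes the polytope finite: a longer cycle enters some side twice and splits there into two
    shorter edge cycles. *)
Lemma short_cycles_suffice z :
  (forall c, edge_cycle c -> (size c <= #|{: cell T * 'I_3}|)%N ->
    0 < \sum_(p <- c) z (side_edge p)) ->
  edge_cycle_polytope R T z.
Proof.
move=> short c; have [n] := ubnP (size c); elim: n c => // n IH c cn cc.
have [uc|/cycle_split] := boolP (uniq c).
  by apply: short => //; rewrite -(card_uniqP uc); exact: max_card.
have /andP[_ ec] := cc => /(_ _ ec)[c1 [c2 [/[dup] /andP[c10 _] cc1 /[dup] /andP[c20 _] cc2 cE]]].
have sE : size c = (size c1 + size c2)%N by rewrite (perm_size cE) size_cat.
have s1 : (0 < size c1)%N by case: (c1) c10.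
have s2 : (0 < size c2)%N by case: (c2) c20.
rewrite (perm_big _ cE) big_cat /= addr_gt0// IH//; move: cn; rewrite sE !ltnS => cn.
  by apply: leq_trans cn; rewrite -addn1 leq_add2l.
by apply: leq_trans cn; rewrite -add1n leq_add2r.
Qed.

End edge_cycles.

(** * Properness *)

Section properness.
Context {R : realType} (T : ideal_triangulation) (lambda : R) (lambda0 : 0 <= lambda).
Implicit Types (l z : edge T -> R) (p q : cell T * 'I_3).

Local Notation F := (cosh_power_integral lambda).
Local Notation nside := #|{: cell T * 'I_3}|.

Lemma tanh_homo (x y : R) : x <= y -> tanh x <= tanh y.
Proof.
move=> xy; have xy0 : 0 <= sinh (y - x) by rewrite -sinh0 ler_sinh// subr_ge0.
suff -> : tanh y = tanh x + sinh (y - x) / (cosh y * cosh x).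
  by rewrite lerDl; exact: divr_ge0 xy0 (ltW (mulr_gt0 (cosh_gt0 y) (cosh_gt0 x))).
rewrite sinhD sinhN coshN /tanh.
have := cosh_gt0 x; have := cosh_gt0 y.
by move: (cosh x) (sinh x) (cosh y) (sinh y) => a b c d c0 a0; field; rewrite !gt_eqF.
Qed.

(** A negative defect is smaller in absolute value than the next one, their sum being a B-arc; as
    [tanh (l / 2) * cosh r] is the same on both sides, the next side is shorter. *)
Lemma rot_side_shorter l p : hyperbolic_metric l -> side_defect l p < 0 ->
  side_length l (rot_side p 1) < side_length l p.
Proof.
move=> l0 p0; rewrite ltNge; apply/negP => pk.
have l0' q : 0 < side_length l q := l0 _.
have pk0 : 0 < side_defect l p + side_defect l (rot_side p 1).
  rewrite side_defect1; exact: half_defectD_gt0.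
have := tanh_half_side_eq (l0' p) (l0' (rot_side p 1)) (l0' (rot_side p 2)).
rewrite -side_defect1 -/(side_defect l p).
apply/eqP; rewrite lt_eqF//.
have tp := tanh_gt0 (divr_gt0 (l0' p) (ltr0n R 2)).
have tpk : tanh (side_length l p / 2) <= tanh (side_length l (rot_side p 1) / 2).
  by apply: tanh_homo; rewrite ler_pM2r// invr_gt0.
have ck : cosh (side_defect l p) < cosh (side_defect l (rot_side p 1)).
  rewrite -coshN; apply: ltr_cosh; move: p0 pk0;
    by move: (side_defect l p) (side_defect l _) => x y; lra.
have h1 : tanh (side_length l p / 2) * cosh (side_defect l p) <
    tanh (side_length l p / 2) * cosh (side_defect l (rot_side p 1)).
  by rewrite (ltr_pM2l tp).
by apply: (lt_le_trans h1); rewrite (ler_pM2r (cosh_gt0 _)).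
Qed.

Let summand_lt0_contra (C u v : R) : u + v <= C -> C < u -> 0 <= v -> False.
Proof. lra. Qed.

Let rank_step_contra (C u v w k' : R) :
  u + v <= C -> w <= k' -> 0 < v + w -> C + k' < u -> False.
Proof. lra. Qed.

Let summand_lower_bound (C u v w : R) : - C <= u + v -> v <= w -> - (C + w) <= u.
Proof. lra. Qed.

Let lipschitz_rearrange (a b c d e : R) : d <= e -> a - - b <= d -> a + c <= c - b + e.
Proof. lra. Qed.

(* Across an edge from a side with a large defect the defect is very negative,
   and leaving that cell one meets a side with a large defect and a strictly
   smaller length; so the defect is controlled by the rank of the length. *)
Lemma side_defect_le_rank l (C : R) : hyperbolic_metric l -> 0 <= C ->
  (forall e, `|edge_invariant lambda l e| <= C) ->
  forall p, F (side_defect l p) <= C *+ #|[set e | l e < l (side_edge p)]%SET|.+1.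
Proof.
move=> l0 C0 psiC p.
have [n] := ubnP #|[set e | l e < l (side_edge p)]%SET|.
elim: n p => // n IH p; rewrite ltnS => pn; rewrite leNgt; apply/negP => Fp.
have [q pq_edge pq] := other_side p.
have := psiC (side_edge q); rewrite (edge_invariant_two_sides lambda l pq_edge pq).
rewrite ler_norml => /andP[_ FpqC].
have CF : C < F (side_defect l p).
  by apply: le_lt_trans Fp; rewrite mulrS lerDl mulrn_wge0.
have q0 : side_defect l q < 0.
  rewrite ltNge; apply/negP => /(cosh_power_integral_homo lambda).
  rewrite cosh_power_integral0.
  exact: summand_lt0_contra FpqC CF.
have kq := rot_side_shorter l0 q0; set k := rot_side q 1 in kq.
have qk0 : 0 < side_defect l q + side_defect l k.
  by rewrite /k side_defect1; apply: half_defectD_gt0; exact: l0.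
have kp : [set e | l e < l (side_edge k)]%SET \proper [set e | l e < l (side_edge p)]%SET.
  apply/properP; split.
    by apply/fintype.subsetP => e; rewrite !inE pq_edge => /lt_trans; apply.
  by exists (side_edge k); rewrite !inE ?ltxx// pq_edge.
have Fk := IH k (leq_trans (proper_card kp) pn).
have {}Fk : F (side_defect l k) <= C *+ #|[set e | l e < l (side_edge p)]%SET|.
  by apply: le_trans Fk _; rewrite ler_wpMn2l// proper_card.
move: Fp; rewrite mulrS => Fp.
exact: rank_step_contra FpqC Fk (cosh_power_integral_gt0 lambda qk0) Fp.
Qed.

(** A rank is at most the number of edges, which bounds [F] from above; the lower bound costs one
    more [C], through the other side of the same edge. *)
Lemma side_defect_bounded l (C : R) : hyperbolic_metric l -> 0 <= C ->
  (forall e, `|edge_invariant lambda l e| <= C) ->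
  forall p, `|side_defect l p| <= C *+ #|edge T|.+2.
Proof.
move=> l0 C0 psiC p.
have FB q : F (side_defect l q) <= C *+ #|edge T|.+1.
  apply: le_trans (side_defect_le_rank l0 C0 psiC q) _.
  by rewrite ler_wpMn2l// ltnS max_card.
have [q pq_edge pq] := other_side p.
have := psiC (side_edge q); rewrite (edge_invariant_two_sides lambda l pq_edge pq).
rewrite ler_norml => /andP[FpqC _]; have Fp := FB p; have Fq := FB q.
have NC : - (C *+ #|edge T|.+2) <= F (side_defect l p).
  rewrite (mulrS _ #|edge T|.+1).
  exact: summand_lower_bound FpqC Fq.
have PC : F (side_defect l p) <= C *+ #|edge T|.+2.
  by apply: le_trans Fp _; exact: ler_wpMn2l.
have K0 : 0 <= C *+ #|edge T|.+2 by rewrite mulrn_wge0.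
rewrite ler_norml; apply/andP; split.
  have [r0|/ltW r0] := leP 0 (side_defect l p).
    by apply: le_trans r0; rewrite oppr_le0.
  rewrite lerNl; apply: le_trans (cosh_power_integral_ge_id lambda0 _) _.
    by rewrite oppr_ge0.
  by rewrite cosh_power_integralN lerNl.
have [r0|/ltW r0] := leP 0 (side_defect l p); last exact: le_trans r0 K0.
exact: le_trans (cosh_power_integral_ge_id lambda0 r0) PC.
Qed.

Let bound_alg (Y s1 s2 S c1 c2 : R) : 0 <= Y -> 0 < s1 -> 0 < s2 -> s1 <= S -> s2 <= S ->
  1 <= c1 -> 1 <= c2 -> Y * (s1 * s2) = c1 * c2 -> 1 <= Y * S ^+ 2.
Proof.
move=> Y0 s10 s20 s1S s2S c11 c21 E.
have cc : 1 <= c1 * c2 by nra.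
rewrite -E in cc; apply: le_trans cc _; rewrite expr2; apply: ler_wpM2l => //.
by apply: ler_pM => //; exact: ltW.
Qed.

(** Bounded defects keep lengths away from 0: in [sinh_half_side] the cosines are at least 1 and
    both sines at most [sinh (K + K)]. *)
Lemma sinh_half_side_ge l (K : R) : hyperbolic_metric l ->
  (forall p, `|side_defect l p| <= K) ->
  forall p, 1 <= sinh (side_length l p / 2) ^+ 2 * sinh (K + K) ^+ 2.
Proof.
move=> l0 rK p; have l0' q : 0 < side_length l q := l0 _.
have := sinh_half_side (l0' p) (l0' (rot_side p 1)) (l0' (rot_side p 2)).
rewrite /= -side_defect1 -side_defect2 -/(side_defect l p).
have xy : 0 < side_defect l p + side_defect l (rot_side p 1).
  by rewrite side_defect1; exact: half_defectD_gt0.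
have xz : 0 < side_defect l p + side_defect l (rot_side p 2).
  by rewrite side_defect2 addrC; exact: half_defectD_gt0.
have sK q : side_defect l p + side_defect l q <= K + K.
  by apply: lerD; exact: le_trans (ler_norm _) (rK _).
apply: bound_alg (sqr_ge0 _) (sinh_gt0 xy) (sinh_gt0 xz) _ _ (cosh_ge1 _) (cosh_ge1 _);
  by apply: ler_sinh.
Qed.

(** The sum of the two defects is the length of the B-arc between the entered side and the exit
    side, so the step turns around a B-arc of length at most [eta]. *)
Definition thin_step l (eta : R) p q : bool :=
  [exists j : 'I_3, [&& j != p.2, side_edge (p.1, j) == side_edge q, q != (p.1, j)
     & side_defect l p + side_defect l (p.1, j) <= eta]].

Let thin_alg (k S b Y Y1 Y2 s1 s2 s3 cx cy cz : R) : 0 < k -> 0 < s1 -> 0 < s2 ->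
  0 < s3 -> s1 <= S -> s2 <= S -> s3 <= S -> 1 <= cx -> 1 <= cy -> 1 <= cz ->
  cy <= b -> cz <= b -> 0 <= Y1 -> 0 <= Y2 -> (b / k) ^+ 2 <= Y ->
  Y * (s1 * s2) = cy * cz -> Y1 * (s3 * s1) = cz * cx -> Y2 * (s2 * s3) = cx * cy ->
  (s1 <= k /\ 1 <= Y1 * (k * S)) \/ (s2 <= k /\ 1 <= Y2 * (k * S)).
Proof.
move=> k0 s10 s20 s30 s1S s2S s3S cx1 cy1 cz1 cyb czb Y10 Y20 bY E E1 E2.
have cc (u v : R) : 1 <= u -> 1 <= v -> 1 <= u * v by nra.
have concl (y s s' : R) : 0 <= y -> 0 < s -> s <= k -> 0 < s' -> s' <= S ->
    1 <= y * (s * s') -> 1 <= y * (k * S).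
  move=> y0 s0 sk s'0 s'S /le_trans; apply; apply: ler_wpM2l => //.
  by apply: ler_pM => //; exact: ltW.
have [s1k|ks1] := leP s1 k.
  by left; split => //; apply: (concl _ s1 s3) => //; rewrite [s1 * _]mulrC E1 cc.
have [s2k|ks2] := leP s2 k.
  by right; split => //; apply: (concl _ s2 s3) => //; rewrite E2 cc.
exfalso.
have : (b / k) ^+ 2 * (k * k) < Y * (s1 * s2).
  have b0 : 0 < b by lra.
  have kk : k * k < s1 * s2 by apply: ltr_pM => //; exact: ltW.
  apply: (@lt_le_trans _ _ ((b / k) ^+ 2 * (s1 * s2))).
    by rewrite ltr_pM2l// exprn_gt0// divr_gt0.
  by apply: ler_wpM2r => //; rewrite mulr_ge0// ltW.
have -> : (b / k) ^+ 2 * (k * k) = b * b by field; rewrite gt_eqF.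
rewrite E; apply/negP; rewrite -leNgt; apply: ler_pM => //; lra.
Qed.

(** A long side [a] forces the product of the sines of its two adjacent B-arcs to be small; the
    threshold [(cosh K / k) ^+ 2] is what prevents both sines from exceeding [k]. The other side
    adjacent to the thin B-arc is then long as well, by [sinh_half_side] applied to it. *)
Lemma thin_exit_hexagon (a b c K k : R) : 0 < a -> 0 < b -> 0 < c -> 0 < k ->
  let x := half_defect a b c in let y := half_defect b c a in
  let z := half_defect c a b in
  `|x| <= K -> `|y| <= K -> `|z| <= K -> (cosh K / k) ^+ 2 <= sinh (a / 2) ^+ 2 ->
  (x + y <= k /\ 1 <= sinh (b / 2) ^+ 2 * (k * sinh (K + K))) \/
  (x + z <= k /\ 1 <= sinh (c / 2) ^+ 2 * (k * sinh (K + K))).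
Proof.
move=> a0 b0 c0 k0 /=.
have /= := sinh_half_side a0 b0 c0; have /= := sinh_half_side b0 c0 a0.
have /= := sinh_half_side c0 a0 b0.
have := half_defectD_gt0 c a0 b0; have := half_defectD_gt0 a b0 c0.
have := half_defectD_gt0 b c0 a0.
move: (half_defect a b c) (half_defect b c a) (half_defect c a b) => x y z.
rewrite (addrC z x) (addrC z y) (addrC y x) => xz yz xy E2 E1 E0 xK yK zK bY.
have sK u v : `|u| <= K -> `|v| <= K -> sinh (u + v) <= sinh (K + K).
  move=> uK vK; apply: ler_sinh; apply: lerD; exact: le_trans (ler_norm _) _.
have [[sk Y1]|[sk Y2]] := thin_alg k0 (sinh_gt0 xy) (sinh_gt0 xz) (sinh_gt0 yz)
  (sK _ _ xK yK) (sK _ _ xK zK) (sK _ _ yK zK) (cosh_ge1 x) (cosh_ge1 y) (cosh_ge1 z)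
  (ler_norm_cosh yK) (ler_norm_cosh zK) (sqr_ge0 _) (sqr_ge0 _) bY E0 E1 E2.
- by left; split; [exact: le_trans (sinh_ge_id (ltW xy)) sk|exact: Y1].
- by right; split; [exact: le_trans (sinh_ge_id (ltW xz)) sk|exact: Y2].
Qed.

Lemma thin_exit l (K k : R) p : hyperbolic_metric l -> 0 < k ->
  (forall q, `|side_defect l q| <= K) ->
  (cosh K / k) ^+ 2 <= sinh (side_length l p / 2) ^+ 2 ->
  exists2 j, j != p.2 & side_defect l p + side_defect l (p.1, j) <= k /\
    1 <= sinh (side_length l (p.1, j) / 2) ^+ 2 * (k * sinh (K + K)).
Proof.
move=> l0 k0 rK bY; have l0' q : 0 < side_length l q := l0 _.
have r1K := rK (rot_side p 1); have r2K := rK (rot_side p 2).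
rewrite side_defect1 in r1K; rewrite side_defect2 in r2K.
have [thin|thin] := thin_exit_hexagon (l0' p) (l0' (rot_side p 1)) (l0' (rot_side p 2))
  k0 (rK p) r1K r2K bY.
- exists (p.2 + 1); first by rewrite -subr_eq0 addrC addKr.
  by rewrite -side_defect1 in thin.
- exists (p.2 + 2); first by rewrite -subr_eq0 addrC addKr.
  by rewrite -side_defect2 in thin.
Qed.

(** The thresholds are chosen backwards: each step must leave a side still long enough for the steps
    that remain. *)
Lemma thin_path (K eta : R) n : 0 < K -> 0 < eta ->
  exists M, forall l p, hyperbolic_metric l ->
    (forall q, `|side_defect l q| <= K) ->
    M <= sinh (side_length l p / 2) ^+ 2 ->
    exists2 c, path (thin_step l eta) p c & size c = n.
Proof.
move=> K0 eta0; elim: n => [|n [M IH]]; first by exists 0 => l p _ _ _; exists [::].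
have S0 : 0 < sinh (K + K) by rewrite sinh_gt0// addr_gt0.
pose M' := Num.max M 1; have M'0 : 0 < M' by rewrite lt_max ltr01 orbT.
(* The second bound makes [sinh (_ / 2) ^+ 2] of the exit side at least [M'], the threshold for [n]
   further steps; [Num.max M 1] keeps the inverse positive. *)
pose k := Num.min eta (M' * sinh (K + K))^-1.
have k0 : 0 < k by rewrite lt_min eta0 invr_gt0 mulr_gt0.
exists ((cosh K / k) ^+ 2) => l p l0 rK bY.
have [j jp [thin Y1]] := thin_exit l0 k0 rK bY.
have [q je jq] := other_side (p.1, j).
have [|c qc cn] := IH l q l0 rK.
  have -> : side_length l q = side_length l (p.1, j) by rewrite /side_length je.
  apply: (@le_trans _ _ M'); first by rewrite le_max lexx.
  have kM : k * sinh (K + K) <= M'^-1.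
    have : k <= (M' * sinh (K + K))^-1 by rewrite /k ge_min lexx orbT.
    by rewrite invfM -ler_pdivlMr.
  rewrite -[leLHS]mul1r -ler_pdivlMr//.
  by apply: le_trans Y1 _; apply: ler_wpM2l kM; exact: sqr_ge0.
exists (q :: c); last by rewrite /= cn.
rewrite /= qc andbT; apply/existsP; exists j; rewrite jp je eqxx eq_sym jq /=.
by apply: le_trans thin _; rewrite /k ge_min lexx.
Qed.

Lemma thin_step_sub l eta : subrel (thin_step l eta) (@edge_step T).
Proof.
by move=> p q /existsP[j /and4P[jp je jq _]]; apply/existsP; exists j; rewrite jp je jq.
Qed.

(** A reverse of [edge_step_gt] up to a small error: the defect at the exit side exceeds minus that
    at [p] by at most [eta], and [F] is Lipschitz on [-K, K]. *)
Lemma thin_step_le l (K eta : R) p q : (forall x, `|side_defect l x| <= K) ->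
  hyperbolic_metric l -> thin_step l eta p q ->
  edge_invariant lambda l (side_edge q) <=
  F (side_defect l q) - F (side_defect l p) + cosh K `^ lambda * eta.
Proof.
move=> rK l0 /existsP[j /and4P[jp /eqP je jq thin]]; rewrite eq_sym in jq.
rewrite (edge_invariant_two_sides lambda l je jq).
have := rK p; rewrite ler_norml => /andP[pK Kp].
have := rK (p.1, j); rewrite ler_norml => /andP[jK Kj].
have pj : - side_defect l p <= side_defect l (p.1, j).
  by rewrite -subr_ge0 opprK addrC; exact/ltW/side_defectD_gt0.
have Np : - K <= - side_defect l p by rewrite lerN2.
have := cosh_power_integral_lipschitz lambda0 Np pj Kj.
have : cosh K `^ lambda * (side_defect l (p.1, j) - - side_defect l p) <= cosh K `^ lambda * eta.
  by apply: (ler_wpM2l (powR_ge0 _ _)); rewrite opprK addrC.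
rewrite cosh_power_integralN.
exact: lipschitz_rearrange.
Qed.

Lemma thin_cycle_sum l (K eta : R) c : (forall x, `|side_defect l x| <= K) ->
  hyperbolic_metric l -> 0 <= eta -> c != [::] -> cycle (thin_step l eta) c ->
  \sum_(p <- c) edge_invariant lambda l (side_edge p) <=
  cosh K `^ lambda * eta *+ size c.
Proof.
move=> rK l0 eta0; case: c => // p c _ pc.
rewrite -(cycle_sum_rcons (fun x => edge_invariant lambda l (side_edge x))).
have := path_sum_le (f := fun p => F (side_defect l p))
  (g := fun p => edge_invariant lambda l (side_edge p))
  (fun p q => @thin_step_le l K eta p q rK l0) pc.
by rewrite last_rcons subrr add0r size_rcons.
Qed.

Lemma sinh_le_linear (x : R) : 0 <= x <= 1 -> sinh x <= cosh 1 * x.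
Proof.
move=> /andP[x0 x1]; move: x0; rewrite le_eqVlt => /predU1P[<-|x0].
  by rewrite sinh0 mulr0.
have cs : {within `[0, x], continuous sinh}.
  by apply: continuous_subspaceT => t; exact: is_derive_continuous (is_derive_sinh t).
have [c] := MVT x0 (fun t _ => is_derive_sinh t) cs.
rewrite in_itv /= => /andP[c0 cx]; rewrite sinh0 !subr0 => ->.
rewrite ler_pM2r//; apply: ler_cosh; first exact: ltW.
exact: ltW (lt_le_trans cx x1).
Qed.

Let inv_lt_alg (s S c x : R) : 0 < S -> 0 < c -> 0 <= s -> s <= c * (x / 2) ->
  x < (c * S)^-1 -> 1 <= s ^+ 2 * S ^+ 2 -> False.
Proof.
move=> S0 c0 s0 sc xS; rewrite -exprMn => sS.
have cS0 : 0 < c * S by exact: mulr_gt0.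
have xcS : x * (c * S) < 1 by rewrite -ltr_pdivlMr// div1r.
have sS1 : s * S < 1.
  apply: (@le_lt_trans _ _ (c * (x / 2) * S)); first by rewrite ler_pM2r.
  by rewrite (_ : _ * S = x * (c * S) / 2); [lra|ring].
have sS0 : 0 <= s * S by rewrite mulr_ge0// ltW.
by move: (s * S) sS sS1 sS0 => u; nra.
Qed.

Lemma length_lower_bound (S x : R) : 0 < S -> 0 < x ->
  1 <= sinh (x / 2) ^+ 2 * S ^+ 2 -> Num.min 1 (cosh 1 * S)^-1 <= x.
Proof.
move=> S0 x0 sS; rewrite leNgt lt_min; apply/negP => /andP[x1 xS].
have x2 : 0 < x / 2 by rewrite divr_gt0.
apply: inv_lt_alg S0 (cosh_gt0 1) (ltW (sinh_gt0 x2)) _ xS sS.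
by apply: sinh_le_linear; rewrite (ltW x2)/=; lra.
Qed.

Lemma length_upper_bound (M x : R) : 0 < x ->
  sinh (x / 2) ^+ 2 < M -> x <= 2 * Num.max M 1.
Proof.
move=> x0; have x2 : 0 <= x / 2 by rewrite divr_ge0// ltW.
have := sinh_ge_id x2; move: (sinh _) => s xs sM.
have : s ^+ 2 < Num.max M 1 by rewrite lt_max sM.
have : 1 <= Num.max M 1 by rewrite le_max lexx orbT.
move: (Num.max M 1) => m m1 sm; have sm' : s <= m by rewrite leNgt; apply/negP => ms; nra.
lra.
Qed.

Let eta_alg (L delta : R) n : 0 < L -> 0 < delta ->
  L * (delta / (L * n.+1%:R)) *+ n < delta.
Proof.
move=> L0 d0; have n0 : 0 < n.+1%:R :> R by rewrite ltr0n.
have -> : L * (delta / (L * n.+1%:R)) = delta / n.+1%:R by field; rewrite !gt_eqF.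
by rewrite -[ltLHS]mulr_natr mulrAC ltr_pdivrMr// ltr_pM2l// ltr_nat.
Qed.

Lemma edge_invariant_proper (C delta : R) : 0 <= C -> 0 < delta ->
  exists A, forall m : edge T -> R,
    (forall e, `|edge_invariant lambda (expR \o m) e| <= C) ->
    (forall c, edge_cycle c -> (size c <= nside)%N ->
       delta <= \sum_(p <- c) edge_invariant lambda (expR \o m) (side_edge p)) ->
    forall e, `|m e| <= A.
Proof.
move=> C0 delta0; pose K := C *+ #|edge T|.+2 + 1.
have K0 : 0 < K by rewrite ltr_wpDl// mulrn_wge0.
have L0 : 0 < cosh K `^ lambda by exact: powR_gt0 (cosh_gt0 K).
(* A thin cycle of at most [nside] steps has sum at most [nside / nside.+1 * delta]; the successor
   makes this strictly less than [delta]. *)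
pose eta := delta / (cosh K `^ lambda * (nside.+1)%:R).
have n0 : 0 < (nside.+1)%:R :> R by rewrite ltr0n.
have eta0 : 0 < eta by apply: divr_gt0 => //; exact: mulr_gt0.
have [M thin] := thin_path nside K0 eta0.
have S0 : 0 < sinh (K + K) by rewrite sinh_gt0// addr_gt0.
pose eps : R := Num.min 1 (cosh 1 * sinh (K + K))^-1.
have eps0 : 0 < eps.
  by rewrite lt_min ltr01 invr_gt0; exact: mulr_gt0 (cosh_gt0 1) S0.
pose top : R := 2 * (Num.max M 1).
exists (`|ln eps| + `|ln top|) => m psiC cyc e.
have l0 : hyperbolic_metric (expR \o m) by move=> x; exact: expR_gt0.
have rK p : `|side_defect (expR \o m) p| <= K.
  apply: le_trans (side_defect_bounded l0 C0 psiC p) _.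
  by rewrite /K lerDl.
have [p pe] := edge_has_side e.
have ln_m : m e = ln (side_length (expR \o m) p) by rewrite /side_length /= pe expRK.
have lp0 : 0 < side_length (expR \o m) p := expR_gt0 _.
have lo : eps <= side_length (expR \o m) p.
  exact: length_lower_bound S0 lp0 (sinh_half_side_ge l0 rK p).
have hi : side_length (expR \o m) p <= top.
  apply: length_upper_bound => //; rewrite ltNge; apply/negP => Mp.
  have [c pc cn] := thin _ p l0 rK Mp.
  (* A path of [nside] steps visits [nside.+1] sides, so one of them is repeated. *)
  have nu : ~~ uniq (p :: c).
    apply/negP => /card_uniqP; have := max_card (mem (p :: c)).
    by rewrite /= cn => + E; rewrite E ltnn.
  have [c' /andP[c'0 ec'] c'n] := path_cycle_short pc nu; rewrite cn in c'n.
  have cc' : edge_cycle c'.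
    by rewrite /edge_cycle c'0; case: (c') ec' => // q s; exact/sub_path/thin_step_sub.
  have := cyc c' cc' c'n.
  apply/negP; rewrite -ltNge.
  apply: le_lt_trans (thin_cycle_sum rK l0 (ltW eta0) c'0 ec') _.
  apply: (@le_lt_trans _ _ (cosh K `^ lambda * eta *+ nside)).
    by apply: ler_wpMn2l c'n; exact: ltW (mulr_gt0 L0 eta0).
  exact: eta_alg.
have top0 : 0 < top := lt_le_trans lp0 hi.
rewrite ln_m ler_norml; apply/andP; split.
  rewrite lerNl; apply: (@le_trans _ _ `|ln eps|); last by rewrite lerDl.
  apply: (@le_trans _ _ (- ln eps)); last by rewrite -normrN ler_norm.
  by rewrite lerN2 ler_ln.
apply: (@le_trans _ _ `|ln top|); last by rewrite lerDr.
apply: (@le_trans _ _ (ln top)); last by rewrite ler_norm.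
by rewrite ler_ln.
Qed.

End properness.

(** * The image *)

Section continuity.
Context {R : realType} {X : topologicalType}.
Implicit Types (f g : X -> R) (x : X).

Lemma eq_continuous_for f g x : (forall y, f y = g y) ->
  {for x, continuous f} -> {for x, continuous g}.
Proof. by move=> /funext ->. Qed.

Lemma continuous_cstf (c : R) x : {for x, continuous (fun _ : X => c)}.
Proof. exact: cvg_cst. Qed.

Lemma continuous_addf f g x : {for x, continuous f} -> {for x, continuous g} ->
  {for x, continuous (fun y => f y + g y)}.
Proof. by move=> cf cg; apply: cvgD. Qed.

Lemma continuous_oppf f x : {for x, continuous f} ->
  {for x, continuous (fun y => - f y)}.
Proof. by move=> cf; apply: cvgN. Qed.

Lemma continuous_mulf f g x : {for x, continuous f} -> {for x, continuous g} ->
  {for x, continuous (fun y => f y * g y)}.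
Proof. by move=> cf cg; apply: cvgM. Qed.

Lemma continuous_invf f x : f x != 0 -> {for x, continuous f} ->
  {for x, continuous (fun y => (f y)^-1)}.
Proof. by move=> fx cf; apply: cvgV. Qed.

Lemma continuous_sumf (I : Type) (r : seq I) (P : pred I) (h : I -> X -> R) x :
  (forall i, P i -> {for x, continuous (h i)}) ->
  {for x, continuous (fun y => \sum_(i <- r | P i) h i y)}.
Proof.
move=> ch; elim: r => [|i r IH].
  apply: (@eq_continuous_for (cst 0)) => [y|]; first by rewrite big_nil.
  exact: cvg_cst.
have [Pi|nPi] := boolP (P i); last first.
  by apply: eq_continuous_for IH => y; rewrite big_cons (negbTE nPi).
apply: eq_continuous_for (continuous_addf (ch i Pi) IH) => y.
by rewrite big_cons Pi.
Qed.

Lemma continuous_compf f (g : R -> R) x : {for x, continuous f} ->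
  {for f x, continuous g} -> {for x, continuous (fun y => g (f y))}.
Proof. exact: continuous_comp. Qed.

Lemma continuous_B_arc f g (h : X -> R) x :
  0 < f x -> 0 < g x -> 0 < h x ->
  {for x, continuous f} -> {for x, continuous g} -> {for x, continuous h} ->
  {for x, continuous (fun y => B_arc (f y) (g y) (h y))}.
Proof.
move=> f0 g0 h0 cf cg ch.
have ccosh (k : X -> R) : {for x, continuous k} -> {for x, continuous (fun y => cosh (k y))}.
  move=> ck; apply: (@continuous_compf k cosh) => //.
  exact: is_derive_continuous (is_derive_cosh _).
have csinh (k : X -> R) : {for x, continuous k} -> {for x, continuous (fun y => sinh (k y))}.
  move=> ck; apply: (@continuous_compf k sinh) => //.
  exact: is_derive_continuous (is_derive_sinh _).
have [d dac] := is_derive_acosh (B_arc_arg_gt1 (f x) g0 h0).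
apply: (@continuous_compf (fun y => (cosh (f y) + cosh (g y) * cosh (h y))
  / (sinh (g y) * sinh (h y))) acosh); last exact: is_derive_continuous dac.
apply: continuous_mulf.
  apply: continuous_addf; first exact: ccosh.
  by apply: continuous_mulf; exact: ccosh.
apply: (@continuous_invf (fun y => sinh (g y) * sinh (h y))).
  exact: lt0r_neq0 (mulr_gt0 (sinh_gt0 g0) (sinh_gt0 h0)).
by apply: continuous_mulf; exact: csinh.
Qed.

Lemma continuous_half_defect f g (h : X -> R) x :
  0 < f x -> 0 < g x -> 0 < h x ->
  {for x, continuous f} -> {for x, continuous g} -> {for x, continuous h} ->
  {for x, continuous (fun y => half_defect (f y) (g y) (h y))}.
Proof.
move=> f0 g0 h0 cf cg ch.
apply: continuous_mulf; last exact: cvg_cst.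
apply: continuous_addf; first by apply: continuous_addf; exact: continuous_B_arc.
by apply: continuous_oppf; exact: continuous_B_arc.
Qed.

Lemma continuous_edge_invariant (T : ideal_triangulation) lambda
    (l : X -> edge T -> R) x e :
  (forall e', 0 < l x e') -> (forall e', {for x, continuous (fun y => l y e')}) ->
  {for x, continuous (fun y => edge_invariant lambda (l y) e)}.
Proof.
move=> l0 cl.
apply: (@eq_continuous_for (fun y => \sum_(p | side_edge p == e)
    cosh_power_integral lambda (side_defect (l y) p))).
  by move=> y; rewrite edge_invariantE.
apply: continuous_sumf => p _.
apply: (@continuous_compf (fun y => side_defect (l y) p)); last first.
  exact: is_derive_continuous (is_derive_cosh_power_integral _ _).
apply: continuous_half_defect.
- exact: l0.
- exact: l0.
- exact: l0.
- exact: cl.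
- exact: cl.
- exact: cl.
Qed.

End continuity.

(** * A variational criterion for surjectivity *)

Section barrier.
Context {R : realType} (E K : finType) (P : pred K).
Implicit Types m v w : E -> R.

Let X : topologicalType := prod_topology (fun _ : E => R).

Let form (a : K -> E -> R) (y : E -> R) k : R := \sum_e a k e * y e.

(** For [u > 0], [x / u + u / x] blows up as [x] tends to 0 from above and is least at [x = u], so
    it guards a facet while keeping [z] critical; the squares bound [y]. *)
Let barrier (a : K -> E -> R) (z y : E -> R) : R :=
  \sum_e (y e - z e) * (y e - z e)
  + \sum_(k | P k) (form a y k / form a z k + form a z k / form a y k).

Let barrier_grad (a : K -> E -> R) (z y : E -> R) e : R :=
  2 * (y e - z e) +
  \sum_(k | P k) ((form a z k)^-1 - form a z k / form a y k ^+ 2) * a k e.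

(** Paired with [y - z], each facet term of the gradient is nonnegative, so a vanishing gradient
    kills the sum of squares. *)
Let barrier_grad_eq0 (a : K -> E -> R) z y :
  (forall k, P k -> 0 < form a z k) -> (forall k, P k -> 0 < form a y k) ->
  (forall e, barrier_grad a z y e = 0) -> y = z.
Proof.
move=> z0 y0 g0.
have : \sum_e barrier_grad a z y e * (y e - z e) = 0.
  by apply: big1 => e _; rewrite g0 mul0r.
under eq_bigr do rewrite mulrDl -mulrA big_distrl/=.
rewrite big_split/= exchange_big/= -big_distrr/= => G0.
have K0 : 0 <= \sum_(k | P k) \sum_e
    ((form a z k)^-1 - form a z k / form a y k ^+ 2) * a k e * (y e - z e).
  apply: sumr_ge0 => k Pk.
  under eq_bigr do rewrite -mulrA.
  rewrite -big_distrr/= (_ : \sum_e _ = form a y k - form a z k); last first.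
    by rewrite /form -sumrB; apply: eq_bigr => e _; rewrite mulrBr.
  have := z0 k Pk; have := y0 k Pk; move: (form a z k) (form a y k) => u x x0 u0.
  rewrite [leRHS](_ : _ = (x - u) ^+ 2 * ((x + u) / (u * x ^+ 2))); last first.
    by field; rewrite !gt_eqF.
  by rewrite mulr_ge0 ?sqr_ge0// divr_ge0 ?addr_ge0 ?mulr_ge0 ?sqr_ge0 ?ltW.
have S0 : \sum_e (y e - z e) * (y e - z e) <= 0.
  move: G0 K0; move: (\sum_e _) (\sum_(k | P k) _) => p q; lra.
have {}S0 : \sum_e (y e - z e) * (y e - z e) = 0.
  apply/eqP; rewrite eq_le S0; apply: sumr_ge0 => e _; exact: sqr_ge0.
have := psumr_eq0P (fun e _ => sqr_ge0 (y e - z e)) S0 => yz.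
apply/funext => e; apply/eqP; rewrite -subr_eq0 -sqrf_eq0; apply/eqP.
exact: (yz e isT).
Qed.

Let is_derive_barrier (a : K -> E -> R) z (y : R -> E -> R) (y' : E -> R) t :
  (forall k, P k -> 0 < form a z k) -> (forall k, P k -> 0 < form a (y t) k) ->
  (forall e, is_derive t 1 (fun s => y s e) (y' e)) ->
  is_derive t 1 (fun s => barrier a z (y s)) (\sum_e y' e * barrier_grad a z (y t) e).
Proof.
move=> z0 y0 dy.
have dform k : is_derive t 1 (fun s => form a (y s) k) (\sum_e a k e * y' e).
  apply: is_derive_eq (is_derive_sumf _ (fun e _ =>
    is_derive_mulf (is_derive_cst (a k e) t 1) (dy e))) _.
  by apply: eq_bigr => e _; rewrite /= mulr0 addr0.
have dterm k : P k -> is_derive t 1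
    (fun s => form a (y s) k / form a z k + form a z k / form a (y s) k)
    ((\sum_e a k e * y' e) * ((form a z k)^-1 - form a z k / form a (y t) k ^+ 2)).
  move=> Pk; have yk0 := lt0r_neq0 (y0 k Pk).
  apply: is_derive_eq (is_derive_addf
    (is_derive_mulf (dform k) (is_derive_cst ((form a z k)^-1) t 1))
    (is_derive_mulf (is_derive_cst (form a z k) t 1)
      (@is_derive_invf _ (fun s => form a (y s) k) _ _ yk0 (dform k)))) _.
  move: (z0 k Pk) yk0 => /lt0r_neq0; rewrite /=.
  by move: (form a z k) (form a (y t) k) (\sum_e _) => u x d u0 x0; field; rewrite u0 x0.
have dsq e : is_derive t 1 (fun s => (y s e - z e) * (y s e - z e))
    (y' e * (2 * (y t e - z e))).
  have dyz := is_derive_addf (dy e) (is_derive_cst (- z e) t 1).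
  apply: is_derive_eq (is_derive_mulf dyz dyz) _.
  by rewrite /=; ring.
apply: is_derive_eq (is_derive_addf (is_derive_sumf _ (fun e _ => dsq e))
  (is_derive_sumf _ dterm)) _.
rewrite /barrier_grad; under [RHS]eq_bigr do rewrite mulrDr.
rewrite big_split/=; congr (_ + _).
under [RHS]eq_bigr do rewrite big_distrr/=.
rewrite exchange_big/=; apply: eq_bigr => k _; rewrite big_distrl/=.
by apply: eq_bigr => e _; rewrite [_ * a k e]mulrC mulrA [a k e * _]mulrC.
Qed.

(* Minimise the barrier composed with [psi].  Properness makes the minimum exist,
   and there the monotonicity of [psi], applied to the gradient of the barrier,
   would give a decreasing direction unless this gradient vanishes. *)
Lemma barrier_surjective (psi : (E -> R) -> E -> R) (a : K -> E -> R) (z : E -> R) :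
  (forall e, continuous (fun m : X => psi m e)) ->
  (forall m v (t : R), exists psi' : E -> R, forall e,
     is_derive t 1 (fun s => psi (fun e' => m e' + s * v e') e) (psi' e)) ->
  (forall m w, (exists e, w e != 0) -> exists v (psi' : E -> R),
     (forall e, is_derive (0 : R) 1 (fun s => psi (fun e' => m e' + s * v e') e) (psi' e)) /\
     \sum_e psi' e * w e < 0) ->
  (forall m k, P k -> 0 < \sum_e a k e * psi m e) ->
  (forall k, P k -> 0 < \sum_e a k e * z e) ->
  (forall C delta : R, 0 <= C -> 0 < delta -> exists A : R, forall m,
     (forall e, `|psi m e| <= C) ->
     (forall k, P k -> delta <= \sum_e a k e * psi m e) -> forall e, `|m e| <= A) ->
  exists m, psi m = z.
Proof.
move=> psi_cont psi_der psi_mono psi_pos z_pos psi_proper.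
pose G m := barrier a z (psi m).
have term_ge0 m k : P k -> 0 <= form a (psi m) k / form a z k + form a z k / form a (psi m) k.
  move=> Pk; have u0 := z_pos k Pk; have x0 := psi_pos m k Pk.
  by rewrite addr_ge0// divr_ge0// ltW.
have G_ge0 m : 0 <= G m.
  apply: addr_ge0; first by apply: sumr_ge0 => e _; exact: sqr_ge0.
  by apply: sumr_ge0 => k Pk; exact: term_ge0.
pose m0 : E -> R := fun=> 0.
pose C : R := 1 + G m0 + \sum_e `|z e|.
have C0 : 0 <= C by rewrite addr_ge0 ?sumr_ge0// addr_ge0.
pose d0 : R := \big[Num.min/1]_(k | P k) form a z k.
have d0_gt0 : 0 < d0 by apply: lt_bigmin.
(* On the sublevel set of [m0] each ratio of the facet form at [z] to that at [psi m] is at most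
   [G m0]; the added 1 keeps the denominator positive. *)
pose delta := d0 / (1 + G m0).
have G1 : 0 < 1 + G m0 by rewrite ltr_pwDl.
have delta0 : 0 < delta by rewrite divr_gt0.
have [A0 proper] := psi_proper C delta C0 delta0.
pose A := Num.max A0 0.
have A_ge0 : 0 <= A by rewrite le_max lexx orbT.
have sublevel m : G m <= G m0 -> forall e, `|m e| <= A.
  move=> Gm e; apply: (@le_trans _ _ A0); last by rewrite le_max lexx.
  have sq_le e' : (psi m e' - z e') * (psi m e' - z e') <= G m0.
    apply: le_trans Gm; rewrite /G /barrier (bigD1 e')//= -addrA lerDl addr_ge0//.
      by apply: sumr_ge0 => ? _; exact: sqr_ge0.
    by apply: sumr_ge0 => k Pk; exact: term_ge0.
  have term_le k : P k -> form a z k / form a (psi m) k <= G m0.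
    move=> Pk; apply: le_trans Gm; rewrite /G /barrier (bigD1 k)//=.
    rewrite addrCA.
    have x0 := psi_pos m k Pk; have u0 := z_pos k Pk.
    have le1 : form a z k / form a (psi m) k <=
        form a (psi m) k / form a z k + form a z k / form a (psi m) k.
      by rewrite lerDr; apply: divr_ge0; exact: ltW.
    apply: (le_trans le1); rewrite lerDl; apply: addr_ge0.
      by apply: sumr_ge0 => ? _; exact: sqr_ge0.
    by apply: sumr_ge0 => ? /andP[? _]; exact: term_ge0.
  apply: proper => [e'|k Pk].
    have : `|psi m e' - z e'| <= 1 + G m0.
      have : `|psi m e' - z e'| * `|psi m e' - z e'| <= G m0.
        by rewrite -normrM ger0_norm ?sq_le//; exact: sqr_ge0.
      move: (G_ge0 m0) (normr_ge0 (psi m e' - z e')).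
      by move: (`|_|) (G m0) => d g g0 d0' dg; nra.
    move=> dist; rewrite -[psi m e'](subrK (z e')).
    apply: le_trans (ler_normD _ _) _; apply: lerD => //.
    by rewrite (bigD1 e')//= lerDl sumr_ge0.
  have x0 := psi_pos m k Pk.
  rewrite /delta ler_pdivrMr//; apply: (@le_trans _ _ (form a z k)).
    exact: bigmin_le_cond.
  have := term_le k Pk; rewrite ler_pdivrMr// => /le_trans; apply.
  by rewrite mulrC ler_pM2l// lerDr.
(* The margin 1 places the minimiser, whose coordinates are bounded by [A], in the interior of the
   box. *)
pose box : set X :=
  [set m | forall e, `[- (A + 1), A + 1]%classic (m e)].
have box_compact : compact box.
  exact: (@tychonoff E (fun _ => R) (fun _ => `[- (A + 1), A + 1]%classic)
    (fun _ => @segment_compact R (- (A + 1)) (A + 1))).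
have A1 : 0 < A + 1 by rewrite ltr_wpDl.
have box0 : box m0 by move=> e /=; rewrite in_itv /= oppr_le0 ltW.
have G_cont : continuous (G : X -> R).
  move=> m.
  have cform k : {for m, continuous (fun m' : X => form a (psi m') k)}.
    exact: (continuous_sumf (h := fun e (m' : X) => a k e * psi m' e)
      (fun e _ => continuous_mulf (@continuous_cstf R X (a k e) m) (psi_cont e m))).
  have csq e : {for m, continuous (fun m' : X => (psi m' e - z e) * (psi m' e - z e))}.
    have cd := continuous_addf (psi_cont e m) (@continuous_cstf R X (- z e) m).
    exact: (continuous_mulf cd cd).
  have cterm k : P k -> {for m, continuous (fun m' : X =>
      form a (psi m') k / form a z k + form a z k / form a (psi m') k)}.
    move=> Pk; have inv := continuous_invf (lt0r_neq0 (psi_pos m k Pk)) (cform k).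
    exact: continuous_addf (continuous_mulf (cform k) (@continuous_cstf R X (form a z k)^-1 m))
      (continuous_mulf (@continuous_cstf R X (form a z k) m) inv).
  exact: continuous_addf (continuous_sumf (fun e _ => csq e)) (continuous_sumf cterm).
have box_ne : box !=set0 by exists m0.
have [m mbox mmin] := compact_EVT_min box_ne box_compact (continuous_subspaceT G_cont).
have mA := sublevel m (mmin m0 (mem_set box0)).
exists m; apply: (barrier_grad_eq0 (a := a)); [exact: z_pos|exact: psi_pos|].
have [//|/existsNP[e /eqP grad_e]] :=
  pselect (forall e, barrier_grad a z (psi m) e = 0).
exfalso.
have [v [psi' [dpsi neg]]] := psi_mono m _ (ex_intro _ e grad_e).
pose h (s : R) := G (fun e' => m e' + s * v e').
have h_der (t : R) : derivable h t 1.
  have [p' dp] := psi_der m v t.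
  have dh := is_derive_barrier z_pos (psi_pos _) dp.
  by case: dh.
(* For times below [eps] in absolute value no coordinate moves by more than 1, so the path stays in
   the box. *)
pose eps : R := (1 + \sum_e `|v e|)^-1.
have v1 : 0 < 1 + \sum_e `|v e| by rewrite ltr_pwDl// sumr_ge0.
have eps0 : 0 < eps by rewrite invr_gt0.
have h_min t : t \in `]- eps, eps[%R -> h 0 <= h t.
  rewrite in_itv /= -ltr_norml => t_eps.
  have -> : h 0 = G m.
    by congr G; apply/funext => e'; rewrite mul0r addr0.
  apply: mmin; apply: mem_set => e' /=; rewrite in_itv /= -ler_norml.
  apply: le_trans (ler_normD _ _) _; apply: lerD => //; rewrite normrM.
  apply: (@le_trans _ _ (eps * (1 + \sum_e `|v e|))); last by rewrite mulVf// gt_eqF.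
  apply: ler_pM => //; first exact: ltW.
  by rewrite (bigD1 e')//= addrCA lerDl addr_ge0// sumr_ge0.
have NN : - eps <= eps by rewrite ge0_cp// ltW.
have in0 : (0 : R) \in `]- eps, eps[%R by rewrite in_itv /= oppr_lt0 eps0.
have dh0 := derive1_at_min NN (fun t _ => h_der t) in0 h_min.
have y0 k : P k -> 0 < form a (psi (fun e' => m e' + 0 * v e')) k by exact: psi_pos.
have dh1 := is_derive_barrier z_pos y0 dpsi.
have := is_derive_unique dh1 dh0.
have -> : (fun e' => m e' + 0 * v e') = m by apply/funext => e'; rewrite mul0r addr0.
by move=> E0; rewrite E0 ltxx in neg.
Qed.

End barrier.

(** * The polytope as a finite system, and the image *)

Section edge_cycle_polytopes.
Context {R : realType} (T : ideal_triangulation).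
Implicit Types (l m z w : edge T -> R).

Local Notation short_seq := {bseq #|{: cell T * 'I_3}| of cell T * 'I_3}.

Definition edge_multiplicity (c : seq (cell T * 'I_3)) (e : edge T) : R :=
  (count (fun p => side_edge p == e) c)%:R.

Lemma sum_edge_multiplicity c z :
  \sum_(p <- c) z (side_edge p) = \sum_e edge_multiplicity c e * z e.
Proof.
elim: c => [|p c IH].
  by rewrite big_nil big1// => e _; rewrite /edge_multiplicity mul0r.
rewrite big_cons IH; under [RHS]eq_bigr do rewrite /edge_multiplicity /= natrD mulrDl.
rewrite big_split/=; congr (_ + _).
rewrite (bigD1 (side_edge p))//= eqxx mul1r big1 ?addr0// => e ep.
by rewrite eq_sym (negbTE ep) mul0r.
Qed.

Lemma edge_cycle_polytopeP z : edge_cycle_polytope R T z <->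
  forall c : short_seq, edge_cycle c -> 0 < \sum_e edge_multiplicity c e * z e.
Proof.
split=> [zP c cc|short]; first by rewrite -sum_edge_multiplicity; exact: zP.
apply: short_cycles_suffice => c cc cn.
by rewrite sum_edge_multiplicity; exact: (short (Bseq cn)).
Qed.

Lemma edge_cycle_polytope_open_convex : open_convex_polytope (edge_cycle_polytope R T).
Proof.
pose S := [set c : short_seq | edge_cycle c]%SET.
exists #|S|, (fun k : 'I_#|S| => edge_multiplicity (enum_val k)), (fun=> 0); split.
  (* An edge cycle is nonempty, so the edge of its first side has nonzero multiplicity. *)
  move=> k; have := enum_valP k; rewrite inE; case: (enum_val k) => -[//|p c] /= _ _.
  by exists (side_edge p); rewrite /edge_multiplicity /= eqxx pnatr_eq0.
apply/seteqP; split => z /= => [/edge_cycle_polytopeP zP k|zP].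
  by apply: zP; have := enum_valP k; rewrite inE.
apply/edge_cycle_polytopeP => c cc; have cS : c \in S by rewrite inE.
by have := zP (enum_rank_in cS c); rewrite enum_rankK_in.
Qed.

Context (lambda : R).

Let psi m := edge_invariant lambda (expR \o m).

Let is_derive_path m v (t : R) e :
  is_derive t 1 (fun s => expR (m e + s * v e)) (expR (m e + t * v e) * v e).
Proof.
have dlin : is_derive t 1 (fun s => m e + s * v e) (v e).
  apply: is_derive_eq (is_derive_addf (is_derive_cst (m e) t 1)
    (is_derive_mulf (is_derive_id t 1) (is_derive_cst (v e) t 1))) _.
  by rewrite mulr0 !add0r mulr1.
exact: (@is_derive_compf _ expR (fun s => m e + s * v e) t _ _ (is_derive_expR _) dlin).
Qed.

Lemma edge_invariant_surj z : 0 <= lambda -> edge_cycle_polytope R T z ->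
  exists2 l, hyperbolic_metric l & edge_invariant lambda l = z.
Proof.
move=> lambda0 zP.
have path_gt0 (m v : edge T -> R) (s : R) e : 0 < expR (m e + s * v e) by exact: expR_gt0.
have [||||||m mz] := @barrier_surjective R (edge T) short_seq
    (fun c => edge_cycle c) psi (fun c => edge_multiplicity c) z.
- move=> e m; apply: continuous_edge_invariant => e'; first exact: expR_gt0.
  apply: (continuous_compf (@proj_continuous _ (fun=> R) e' m)).
  exact: is_derive_continuous (is_derive_expR _).
- move=> m v t.
  have [psi' [dpsi _]] := edge_invariant_variation (path_gt0 m v)
    (is_derive_path m v t) (fun e => erefl (tanh (expR (m e + t * v e) / 2)
      `^ (lambda + 1) * (expR (m e + t * v e) * v e))).
  by exists psi'.
- move=> m w w0.
  (* [k] is the derivative of the coordinate [u] with respect to [m]; dividing by it gives the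
     direction whose velocity in [u] is [w]. *)
  pose k e := tanh (expR (m e) / 2) `^ (lambda + 1) * expR (m e).
  have k0 e : k e != 0.
    apply: lt0r_neq0; apply: mulr_gt0 (expR_gt0 _); apply: powR_gt0.
    exact: tanh_gt0 (divr_gt0 (expR_gt0 _) (ltr0n R 2)).
  pose v e := w e / k e; exists v.
  have wE e : w e = tanh (expR (m e + 0 * v e) / 2) `^ (lambda + 1)
      * (expR (m e + 0 * v e) * v e).
    by rewrite mul0r addr0 mulrA -/(k e) /v mulrC divfK.
  have [psi' [dpsi neg]] := edge_invariant_variation (path_gt0 m v)
    (is_derive_path m v 0) wE.
  by exists psi'; split => //; exact: neg.
- move=> m c cc; rewrite -sum_edge_multiplicity.
  by apply: edge_invariant_in_polytope cc => e; exact: expR_gt0.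
- by move=> c cc; rewrite -sum_edge_multiplicity; exact: zP.
- move=> C delta C0 delta0.
  have [A AP] := edge_invariant_proper T lambda0 C0 delta0.
  exists A => m psiC cyc; apply: AP => // c cc cn.
  by rewrite sum_edge_multiplicity; exact: (cyc (Bseq cn)).
by exists (expR \o m) => // e; exact: expR_gt0.
Qed.

Lemma edge_invariants_eq : 0 <= lambda ->
  edge_invariants R T lambda = edge_cycle_polytope R T.
Proof.
move=> lambda0; apply/seteqP; split => z.
  by move=> [l /= l0 <-]; exact: edge_invariant_in_polytope.
by move=> /(edge_invariant_surj lambda0)[l l0 <-]; exists l.
Qed.

End edge_cycle_polytopes.

Theorem theorem1p3 (R : realType) (T : ideal_triangulation) (lambda : R) :
  (forall l l' : edge T -> R,
     hyperbolic_metric l -> hyperbolic_metric l' ->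
     edge_invariant lambda l = edge_invariant lambda l' -> l = l') /\
  (0 <= lambda ->
     [/\ edge_invariants R T lambda = edge_cycle_polytope R T,
         open_convex_polytope (edge_invariants R T lambda)
       & edge_invariants R T lambda = edge_invariants R T 0]).
Proof.
split=> [l l' l0 l'0|lambda0]; first exact: edge_invariant_inj.
rewrite !edge_invariants_eq//; split => //.
exact: edge_cycle_polytope_open_convex.
Qed.
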